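(* Let $(\mathfrak g,[\cdot,\cdots,\cdot]_{\mathfrak g},\alpha)$ be an $n$-Hom-Lie algebra and let $(V,\rho,\beta)$ be a representation of it. For $p\ge 1$ and $f\in C^p(\mathfrak g;V)$, define $\delta f\in C^{p+1}(\mathfrak g;V)$ by $$\begin{aligned} (\delta f)(X_1,\ldots,X_p,z)=&\sum_{1\le i<k\le p}(-1)^i\,\beta f\big(\widetilde\alpha^{-1}(X_1),\ldots,\widehat{X_i},\ldots,\widetilde\alpha^{-1}(X_{k-1}),[\widetilde\alpha^{-2}(X_i),\widetilde\alpha^{-2}(X_k)]_F,\widetilde\alpha^{-1}(X_{k+1}),\ldots,\widetilde\alpha^{-1}(X_p),\alpha^{-1}(z)\big)\\ &+\sum_{i=1}^p(-1)^i\,\beta f\big(\widetilde\alpha^{-1}(X_1),\ldots,\widehat{X_i},\ldots,\widetilde\alpha^{-1}(X_p),[\widetilde\alpha^{-2}(X_i),\alpha^{-2}(z)]_{\mathfrak g}\big)\\ &+\sum_{i=1}^p(-1)^{i+1}\rho(X_i)\,f\big(\widetilde\alpha^{-1}(X_1),\ldots,\widehat{X_i},\ldots,\widetilde\alpha^{-1}(X_p),\alpha^{-1}(z)\big)\\ &+\sum_{i=1}^{n-1}(-1)^{n+p-i+1}\rho\big(x_p^1,\ldots,\widehat{x_p^i},\ldots,x_p^{n-1},z\big)\,f\big(\widetilde\alpha^{-1}(X_1),\ldots,\widetilde\alpha^{-1}(X_{p-1}),\alpha^{-1}(x_p^i)\big) \end{aligned}$$ for all $X_i=x_i^1\wedge\cdots\wedge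 x_i^{n-1}\in\wedge^{n-1}\mathfrak g$ and $z\in\mathfrak g$, where a hat means that the entry is omitted. Then $\delta^2=0$, i.e. $\delta(\delta f)=0$ for all $p\ge1$ and $f\in C^p(\mathfrak g;V)$. Thus $\big(C^\bullet(\mathfrak g;V)=\bigoplus_{p\ge1}C^p(\mathfrak g;V),\delta\big)$ is a well-defined cochain complex.
   Context: All vector spaces are over an algebraically closed field $\mathbb K$ of characteristic $0$; $n\ge2$ is an integer. An $n$-Hom-Lie algebra $(\mathfrak g,[\cdot,\cdots,\cdot]_{\mathfrak g},\alpha)$ is a vector space $\mathfrak g$ with a linear map $[\cdot,\cdots,\cdot]_{\mathfrak g}:\wedge^n\mathfrak g\to\mathfrak g$ and an algebra automorphism $\alpha:\mathfrak g\to\mathfrak g$ (a linear bijection with $\alpha[x_1,\ldots,x_n]_{\mathfrak g}=[\alpha(x_1),\ldots,\alpha(x_n)]_{\mathfrak g}$) such that for all $x_1,\ldots,x_{n-1},y_1,\ldots,y_n\in\mathfrak g$ $$[\alpha(x_1),\ldots,\alpha(x_{n-1}),[y_1,\ldots,y_n]_{\mathfrak g}]_{\mathfrak g}=\sum_{i=1}^n[\alpha(y_1),\ldots,\alpha(y_{i-1}),[x_1,\ldots,x_{n-1},y_i]_{\mathfrak g},\alpha(y_{i+1}),\ldots,\alpha(y_n)]_{\mathfrak g}.$$ Define $\widetilde\alpha:\wedge^{n-1}\mathfrak g\to\wedge^{n-1}\mathfrak g$ by $\widetilde\alpha(x_1\wedge\cdots\wedge x_{n-1})=\alpha(x_1)\wedge\cdots\wedge\alpha(x_{n-1})$.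 For $X=x_1\wedge\cdots\wedge x_{n-1}$, $Y=y_1\wedge\cdots\wedge y_{n-1}$ and $z\in\mathfrak g$ put $[X,z]_{\mathfrak g}=[x_1,\ldots,x_{n-1},z]_{\mathfrak g}$ and $$[X,Y]_F=\sum_{i=1}^{n-1}\alpha(y_1)\wedge\cdots\wedge\alpha(y_{i-1})\wedge[x_1,\ldots,x_{n-1},y_i]_{\mathfrak g}\wedge\alpha(y_{i+1})\wedge\cdots\wedge\alpha(y_{n-1}),$$ extended bilinearly. A representation $(V,\rho,\beta)$ of $\mathfrak g$ consists of a vector space $V$, $\beta\in GL(V)$ and a linear map $\rho:\wedge^{n-1}\mathfrak g\to\mathfrak{gl}(V)$ (we write $\rho(x_1,\ldots,x_{n-1})=\rho(x_1\wedge\cdots\wedge x_{n-1})$) such that for all $X,Y\in\wedge^{n-1}\mathfrak g$ and $x_1,\ldots,x_{n-2},y_1,\ldots,y_n\in\mathfrak g$: (i) $\rho(\widetilde\alpha(X))\circ\beta=\beta\circ\rho(X)$; (ii) $\rho(\widetilde\alpha(X))\circ\rho(Y)-\rho(\widetilde\alpha(Y))\circ\rho(X)=\rho([X,Y]_F)\circ\beta$; (iii) $\rho(\alpha(x_1),\ldots,\alpha(x_{n-2}),[y_1,\ldots,y_n]_{\mathfrak g})\circ\beta=\sum_{i=1}^n(-1)^{n-i}\rho(\alpha(y_1),\ldots,\widehat{\alpha(y_i)},\ldots,\alpha(y_n))\circ\rho(x_1,\ldots,x_{n-2},y_i)$. Cochains: $C^p(\mathfrak g;V)$ is the space of multilinear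 maps $f:\wedge^{n-1}\mathfrak g\otimes\overset{(p-1)}{\cdots}\otimes\wedge^{n-1}\mathfrak g\wedge\mathfrak g\to V$. That is, $C^1(\mathfrak g;V)=\mathrm{Hom}(\mathfrak g,V)$, and for $p\ge2$ an element is a multilinear map $f(X_1,\ldots,X_{p-1},z)$ with $X_i\in\wedge^{n-1}\mathfrak g$, $z\in\mathfrak g$, which is totally skew-symmetric in the $n$ arguments $x_{p-1}^1,\ldots,x_{p-1}^{n-1},z$ (equivalently a linear map $(\wedge^{n-1}\mathfrak g)^{\otimes(p-2)}\otimes\wedge^n\mathfrak g\to V$). *)

(* Defs.v *)
From HB Require Import structures.
From mathcomp.multinomials Require Import freeg.
From mathcomp Require Import all_boot all_order all_algebra perm.
From mathcomp Require Import boolp functions generic_quotient ring_quotient.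

Set Implicit Arguments.
Unset Strict Implicit.
Unset Printing Implicit Defensive.

Import GRing.Theory.
Local Open Scope ring_scope.
Local Open Scope quotient_scope.

Definition upd (k : nat) (T : Type) (x : 'I_k -> T) (i : 'I_k) (u : T) :
  'I_k -> T := fun j => if j == i then u else x j.

(* (x_1, ..., x_(k-1), z); a plain total function of k, so that it can be used
   with k = n and k = n - 1 without casts *)
Definition snoc (k : nat) (T : Type) (x : 'I_k.-1 -> T) (z : T) : 'I_k -> T :=
  fun i => oapp x z (insub (i : nat)).

Definition omit (k : nat) (T : Type) (i : 'I_k) (x : 'I_k -> T) :
  'I_k.-1 -> T := fun j => x (lift i j).

Lemma upd_comp (k : nat) (S T : Type) (f : S -> T) (x : 'I_k -> S) i u :
  f \o upd x i u = upd (f \o x) i (f u).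
Proof. by apply/funext => j; rewrite /upd /=; case: ifP. Qed.

Lemma snoc_upd (k : nat) (T : Type) (i : 'I_k.-1) : exists j : 'I_k,
  [/\ j = i :> nat,
   (forall x (z u : T),
      snoc (upd x i u) z = upd (snoc x z) j u)
   & (forall x (z : T), snoc x z j = x i)].
Proof.
have lik : (i < k)%N by apply: leq_trans (ltn_ord i) (leq_pred k).
exists (Ordinal lik); split=> [//|x z u|x z]; last by rewrite /snoc /= valK.
apply/funext => j; rewrite /snoc /upd; case: insubP => [m _ mj|jk] /=.
  by rewrite -!val_eqE /= mj.
case: eqP => // ej; move: jk; rewrite ej /= => /negP[]; exact: ltn_ord.
Qed.

Lemma snoc_last (k : nat) : (0 < k)%N -> exists j : 'I_k,
  forall T (x : 'I_k.-1 -> T) (z u : T), snoc x u = upd (snoc x z) j u.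
Proof.
case: k => // k _; exists ord_max => T x z u; apply/funext => j.
rewrite /snoc /upd -val_eqE /=; case: insubP => [m _ mj|jk] /=.
  by rewrite -mj (ltn_eqF (ltn_ord m)).
by move: (ltn_ord j); rewrite ltnS leq_eqVlt (negbTE jk) orbF => ->.
Qed.

Section Multilinear.
Variables (K : fieldType) (k : nat) (U V : lmodType K).
Implicit Types (f : ('I_k -> U) -> V).

Definition multilinear f : Prop :=
  forall i x (a : K) (u v : U),
    f (upd x i (a *: u + v)) = a *: f (upd x i u) + f (upd x i v).

Definition alternating f : Prop :=
  forall x i j, i != j -> x i = x j -> f x = 0.

End Multilinear.

(* The k-th exterior power of U: the free K-module on k-tuples of vectors,
   modulo the submodule generated by the multilinearity and alternation
   relations *)
Section ExteriorPower.
Variables (K : fieldType) (k : nat) (U : lmodType K).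

Local Notation free := {freeg ('I_k -> U) / K}.
Local Notation gen x := (Freeg [:: (1, x)] : free).

Inductive ext_null : free -> Prop :=
| ext_null0 : ext_null 0
| ext_nullP (a : K) (u v : free) :
    ext_null u -> ext_null v -> ext_null (a *: u + v)
| ext_null_lin (x : 'I_k -> U) (i : 'I_k) (a : K) (u v : U) :
    ext_null (gen (upd x i (a *: u + v))
              - (a *: gen (upd x i u) + gen (upd x i v)))
| ext_null_alt (x : 'I_k -> U) (i j : 'I_k) :
    i != j -> x i = x j -> ext_null (gen x).

Definition ext_null_pred : {pred free} := fun u => `[< ext_null u >].

Fact ext_null_submod_closed : submod_closed ext_null_pred.
Proof.
split=> [|a u v]; first by apply/asboolP; exact: ext_null0.
by move=> /asboolP Hu /asboolP Hv; apply/asboolP; exact: ext_nullP.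
Qed.

HB.instance Definition _ :=
  GRing.isSubmodClosed.Build K free ext_null_pred ext_null_submod_closed.

Definition extpow : Type := Quotient.quot ext_null_pred.

HB.instance Definition _ := GRing.Zmodule.on extpow.

Definition ext_proj (u : free) : extpow :=
  \pi_(Quotient.quot ext_null_pred) u.
Local Notation proj := ext_proj.
Definition ext_repr (X : extpow) : free :=
  repr (X : Quotient.quot ext_null_pred).
Local Notation rep := ext_repr.

Let repK X : proj (rep X) = X.
Proof. exact: reprK. Qed.

Let projP u v : reflect (proj u = proj v) (u - v \in ext_null_pred).
Proof. by rewrite Quotient.idealrBE; exact: eqP. Qed.

Let projD u v : proj (u + v) = proj u + proj v.
Proof. exact: raddfD. Qed.

Definition ext_scale (a : K) (X : extpow) : extpow := proj (a *: rep X).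

Let projZ a u : proj (a *: u) = ext_scale a (proj u).
Proof.
apply/projP; rewrite -scalerBr rpredZ //.
by apply/projP; rewrite repK.
Qed.

Fact ext_scalerA a b X : ext_scale a (ext_scale b X) = ext_scale (a * b) X.
Proof. by rewrite -[X]repK -!projZ scalerA. Qed.
Fact ext_scale1r : left_id 1 ext_scale.
Proof. by move=> X; rewrite -[X]repK -projZ scale1r. Qed.
Fact ext_scalerDr : right_distributive ext_scale +%R.
Proof.
by move=> a X Y; rewrite -[X]repK -[Y]repK -projD -!projZ -projD scalerDr.
Qed.
Fact ext_scalerDl X : {morph ext_scale^~ X : a b / a + b}.
Proof. by move=> a b; rewrite -[X]repK -!projZ -projD scalerDl. Qed.

HB.instance Definition _ := GRing.Zmodule_isLmodule.Build K extpow
  ext_scalerA ext_scale1r ext_scalerDr ext_scalerDl.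

Definition wedge (x : 'I_k -> U) : extpow := proj (gen x).

Lemma wedge_multilinear : multilinear wedge.
Proof.
move=> i x a u v; rewrite /wedge.
transitivity (proj (a *: gen (upd x i u) + gen (upd x i v))).
  by apply/projP; apply/asboolP; exact: ext_null_lin.
by rewrite projD projZ.
Qed.

Lemma wedge_alternating : alternating wedge.
Proof.
move=> x i j ij xij; transitivity (proj 0); last exact: raddf0.
by apply/projP; rewrite subr0; apply/asboolP; exact: ext_null_alt ij xij.
Qed.

Lemma ext_ind (P : extpow -> Prop) :
  P 0 -> (forall a x X, P X -> P (a *: wedge x + X)) -> forall X, P X.
Proof.
move=> P0 PS X; rewrite -[X]repK; elim/freeg_ind_dom0: (rep X) => [|a x D _ _].
  by have -> : proj 0 = 0 by exact: raddf0.
suff -> : Freeg [:: (a, x)] = a *: gen x :> free.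
  by rewrite projD projZ; exact: PS.
by apply/eqP/freeg_eqP => y; rewrite coeffZ !coeffU mul1r.
Qed.

(* The linear map on the exterior power induced by phi; meaningful when phi
   is multilinear and alternating, see ext_lift_linear and ext_liftE. *)
Definition ext_lift (V : lmodType K) (phi : ('I_k -> U) -> V) (X : extpow) : V :=
  fglift phi (rep X).

Section Lift.
Variables (V : lmodType K) (phi : ('I_k -> U) -> V).

Let lift_linear a u v :
  fglift phi (a *: u + v) = a *: fglift phi u + fglift phi v.
Proof.
have liftB := lift_is_additive phi.
have lift0 : fglift phi 0 = 0 by rewrite -[X in fglift _ X](subrr 0) liftB subrr.
have liftN w : fglift phi (- w) = - fglift phi w.
  by rewrite -[- w]sub0r liftB lift0 sub0r.
have liftD w t : fglift phi (w + t) = fglift phi w + fglift phi t.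
  by rewrite -[t]opprK liftB !liftN opprK.
have liftS (s : seq ('I_k -> U)) F :
    fglift phi (\sum_(y <- s) F y) = \sum_(y <- s) fglift phi (F y).
  by elim: s => [|y s IH]; rewrite ?big_nil // !big_cons liftD IH.
rewrite liftD; congr (_ + _); rewrite -{2}[u]freeg_sumE.
rewrite (_ : a *: u = fgscale a u) // /fgscale !liftS scaler_sumr.
by apply: eq_bigr => y _; rewrite !liftU scalerA.
Qed.

Hypotheses (phi_lin : multilinear phi) (phi_alt : alternating phi).

Let lift_gen x : fglift phi (gen x) = phi x.
Proof. by rewrite liftU scale1r. Qed.

Let lift_null u : ext_null u -> fglift phi u = 0.
Proof.
have liftB := lift_is_additive phi.
elim=> {u} [|a u v _ Hu _ Hv|x i a u v|x i j ij xij].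
- by rewrite -[X in fglift _ X](subrr 0) liftB subrr.
- by rewrite lift_linear Hu Hv scaler0 addr0.
- by rewrite liftB lift_linear !lift_gen phi_lin subrr.
- by rewrite lift_gen; exact: phi_alt ij xij.
Qed.

Let lift_proj u : ext_lift phi (proj u) = fglift phi u.
Proof.
apply/eqP; rewrite -subr_eq0 -(lift_is_additive phi); apply/eqP.
by apply: lift_null; apply/asboolP; apply/projP; rewrite repK.
Qed.

Lemma ext_liftE x : ext_lift phi (wedge x) = phi x.
Proof. by rewrite lift_proj lift_gen. Qed.

Lemma ext_lift_linear a X Y :
  ext_lift phi (a *: X + Y) = a *: ext_lift phi X + ext_lift phi Y.
Proof.
rewrite -[X]repK -[Y]repK.
have -> : a *: proj (rep X) + proj (rep Y) = proj (a *: rep X + rep Y).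
  by rewrite projD projZ.
by rewrite !lift_proj lift_linear.
Qed.

End Lift.
End ExteriorPower.
Arguments extpow {K} k U.

(* The induced map of a linear f : U -> V on exterior powers. *)
Definition ext_map (K : fieldType) (k : nat) (U V : lmodType K) (f : U -> V) :
  extpow k U -> extpow k V := ext_lift (fun x => wedge (f \o x)).

Section ExtMap.
Variables (K : fieldType) (k : nat) (U V : lmodType K) (f : {linear U -> V}).

Let map_lin : multilinear (fun x : 'I_k -> U => wedge (f \o x)).
Proof. by move=> i x a u v; rewrite !upd_comp linearP wedge_multilinear. Qed.

Let map_alt : alternating (fun x : 'I_k -> U => wedge (f \o x)).
Proof. by move=> x i j ij xij; apply: wedge_alternating ij _ => /=; rewrite xij. Qed.

Lemma ext_mapE (x : 'I_k -> U) : ext_map f (wedge x) = wedge (f \o x).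
Proof. exact: ext_liftE map_lin map_alt x. Qed.

Lemma ext_map_linear : linear (@ext_map K k U V f).
Proof. by move=> a X Y; exact: ext_lift_linear map_lin map_alt a X Y. Qed.
End ExtMap.

Record nHomLie (K : fieldType) (n : nat) (g : lmodType K) := NHomLie {
  hl_br : {linear extpow n g -> g};
  hl_alpha : {linear g -> g};
  hl_alphaV : g -> g;
  hl_alphaK : cancel hl_alpha hl_alphaV;
  hl_alphaVK : cancel hl_alphaV hl_alpha;
  hl_alpha_br : forall x : 'I_n -> g,
    hl_alpha (hl_br (wedge x)) = hl_br (wedge (hl_alpha \o x));
  hl_jacobi : forall (x : 'I_n.-1 -> g) (y : 'I_n -> g),
    hl_br (wedge (snoc (hl_alpha \o x) (hl_br (wedge y)))) =
    \sum_(i < n) hl_br (wedge (upd (hl_alpha \o y) i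
                                  (hl_br (wedge (snoc x (y i))))))
}.

Section NHomLieOps.
Variables (K : fieldType) (n : nat) (g : lmodType K) (A : nHomLie n g).

Local Notation W := (extpow n.-1 g).

Definition alphaT : W -> W := ext_map (hl_alpha A).
Definition alphaTV : W -> W := ext_map (hl_alphaV A).

(* [X, z]_g, extended linearly from decomposable X *)
Definition act (X : W) (z : g) : g :=
  ext_lift (fun x => hl_br A (wedge (snoc x z))) X.

Let br_snoc_lin z : multilinear (fun x => hl_br A (wedge (snoc x z))).
Proof.
move=> i x a u v; have [j [_ ju _]] := snoc_upd g i.
by rewrite !ju wedge_multilinear linearP.
Qed.

Let br_snoc_alt z : alternating (fun x => hl_br A (wedge (snoc x z))).
Proof.
move=> x i j ij xij.
have [i' [ii _ iE]] := snoc_upd g i; have [j' [jj _ jE]] := snoc_upd g j.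
rewrite (@wedge_alternating _ _ _ _ i' j') ?linear0 ?iE ?jE //.
by rewrite -val_eqE /= ii jj.
Qed.

(* [X, Y]_F, extended bilinearly from decomposable X and Y *)
Definition brF (X Y : W) : W :=
  ext_lift (fun y => \sum_(i < n.-1)
    wedge (upd (hl_alpha A \o y) i (act X (y i)))) Y.
Lemma actE x z : act (wedge x) z = hl_br A (wedge (snoc x z)).
Proof. exact: ext_liftE (br_snoc_lin z) (br_snoc_alt z) x. Qed.

Lemma act_linearl z : linear (act^~ z).
Proof.
move=> a X Y; exact: ext_lift_linear (br_snoc_lin z) (br_snoc_alt z) a X Y.
Qed.

Lemma act_linearr X : (0 < n)%N -> linear (act X).
Proof.
move=> n0 a u v; elim/ext_ind: X => [|b x X IH].
  suff act0 z : act 0 z = 0 by rewrite !act0 scaler0 addr0.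
  by have := act_linearl z (-1) 0 0; rewrite scaler0 addr0 scaleN1r addNr.
have [j jE] := snoc_last n0.
rewrite !act_linearl IH !actE (jE _ x 0 (a *: u + v)) wedge_multilinear linearP.
by rewrite -!jE !scalerDr !scalerA addrACA [a * b]mulrC.
Qed.

Let deriv (X : W) (y : 'I_n.-1 -> g) : W :=
  \sum_(i < n.-1) wedge (upd (hl_alpha A \o y) i (act X (y i))).

Let updC (T : Type) k (x : 'I_k -> T) i j u v :
  i != j -> upd (upd x i u) j v = upd (upd x j v) i u.
Proof.
move=> ij; apply/funext => m; rewrite /upd.
by case: (eqVneq m j) => // ->; rewrite [j == i]eq_sym (negbTE ij).
Qed.

Let upd_id (T : Type) k (x : 'I_k -> T) i u v :
  upd (upd x i u) i v = upd x i v.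
Proof. by apply/funext => m; rewrite /upd; case: (m == i). Qed.

Let deriv_lin X : (0 < n)%N -> multilinear (deriv X).
Proof.
move=> n0 i y a u v; rewrite /deriv scaler_sumr -big_split /=.
apply: eq_bigr => j _; rewrite !upd_comp.
have [-> | ji] := eqVneq j i.
  by rewrite !upd_id /upd eqxx act_linearr // -/(upd _ _ _) wedge_multilinear.
have yj w : upd y i w j = y j by rewrite /upd (negbTE ji).
rewrite !yj 3?(@updC _ _ _ i j) 1?eq_sym // linearP.
exact: wedge_multilinear.
Qed.

Let wedge_swap k (x : 'I_k -> g) i j u v : i != j ->
  wedge (upd (upd x i u) j v) = - wedge (upd (upd x i v) j u).
Proof.
move=> ij.
have alt w : wedge (upd (upd x i w) j w) = 0.
  by apply: (wedge_alternating ij); rewrite /upd eqxx (negbTE ij) eqxx.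
have addj y w t : wedge (upd y j (w + t)) = wedge (upd y j w) + wedge (upd y j t).
  by rewrite -[w]scale1r wedge_multilinear !scale1r.
have addi y w t : wedge (upd y i (w + t)) = wedge (upd y i w) + wedge (upd y i t).
  by rewrite -[w]scale1r wedge_multilinear !scale1r.
have := alt (u + v); rewrite addj !(updC _ _ _ ij) !addi -!(updC _ _ _ ij) !alt.
by rewrite add0r addr0 addrC => /eqP; rewrite addr_eq0 => /eqP ->.
Qed.

Let deriv_alt X : alternating (deriv X).
Proof.
move=> y i j ij yij; rewrite /deriv (bigD1 i) //= (bigD1 j) 1?eq_sym //=.
rewrite big1 => [|m /andP[mi mj]]; last first.
  apply: (wedge_alternating ij); rewrite /upd ![_ == m]eq_sym.
  by rewrite (negbTE mi) (negbTE mj) /= yij.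
rewrite addr0 yij; set t := hl_alpha A (y j); set w := act X (y j).
have E m : y m = y j -> upd (hl_alpha A \o y) m t = hl_alpha A \o y.
  move=> ym; apply/funext => l; rewrite /upd.
  by case: eqP => // ->; rewrite /= ym.
have -> : upd (hl_alpha A \o y) i w = upd (upd (hl_alpha A \o y) i w) j t.
  by rewrite updC // E.
have -> : upd (hl_alpha A \o y) j w = upd (upd (hl_alpha A \o y) i t) j w.
  by rewrite E.
by rewrite wedge_swap // addNr.
Qed.

Lemma brFE x y : (0 < n)%N -> brF (wedge x) (wedge y) =
  \sum_(i < n.-1) wedge (upd (hl_alpha A \o y) i (hl_br A (wedge (snoc x (y i))))).
Proof.
move=> n0; rewrite /brF (ext_liftE (deriv_lin _ n0) (@deriv_alt _)) /deriv.
by apply: eq_bigr => i _; rewrite actE.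
Qed.

Lemma brF_linearr X : (0 < n)%N -> linear (brF X).
Proof.
move=> n0 a Y Z; exact: ext_lift_linear (deriv_lin _ n0) (@deriv_alt _) a Y Z.
Qed.

Lemma brF_linearl Y : (0 < n)%N -> linear (brF^~ Y).
Proof.
move=> n0 a X X'; elim/ext_ind: Y => [|b y Y IH].
  suff brF0 Z : brF Z 0 = 0 by rewrite !brF0 scaler0 addr0.
  by have := brF_linearr Z n0 (-1) 0 0; rewrite scaler0 addr0 scaleN1r addNr.
rewrite !brF_linearr // IH scalerDr !scalerA addrACA; congr (_ + _).
rewrite /brF !(ext_liftE (deriv_lin _ n0) (@deriv_alt _)) /deriv.
rewrite [a * b]mulrC -[(b * a) *: _]scalerA -scalerDr; congr (_ *: _).
rewrite scaler_sumr -big_split; apply: eq_bigr => i _ /=.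
by rewrite act_linearl wedge_multilinear.
Qed.

Lemma alphaTE x : alphaT (wedge x) = wedge (hl_alpha A \o x).
Proof. exact: ext_mapE. Qed.

Fact hl_alphaV_linear : linear (hl_alphaV A).
Proof.
move=> a u v; apply: (can_inj (@hl_alphaK _ _ _ A)).
by rewrite linearP !hl_alphaVK.
Qed.

HB.instance Definition _ :=
  GRing.isLinear.Build K g g *:%R (hl_alphaV A) hl_alphaV_linear.

Lemma alphaTVE x : alphaTV (wedge x) = wedge (hl_alphaV A \o x).
Proof. exact: ext_mapE. Qed.

Lemma alphaT_linear : linear alphaT.
Proof. exact: ext_map_linear. Qed.

Lemma alphaTV_linear : linear alphaTV.
Proof. exact: ext_map_linear. Qed.

HB.instance Definition _ :=
  GRing.isLinear.Build K W W *:%R alphaT alphaT_linear.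
HB.instance Definition _ :=
  GRing.isLinear.Build K W W *:%R alphaTV alphaTV_linear.

Lemma alphaTK : cancel alphaT alphaTV.
Proof.
elim/ext_ind => [|a x X IH]; first by rewrite !linear0.
rewrite !linearP /= IH alphaTE alphaTVE; congr (_ *: wedge _ + _).
by apply/funext => i /=; rewrite hl_alphaK.
Qed.

Lemma alphaTVK : cancel alphaTV alphaT.
Proof.
elim/ext_ind => [|a x X IH]; first by rewrite !linear0.
rewrite !linearP /= IH alphaTVE alphaTE; congr (_ *: wedge _ + _).
by apply/funext => i /=; rewrite hl_alphaVK.
Qed.

End NHomLieOps.

Record representation (K : fieldType) (n : nat) (g : lmodType K)
    (A : nHomLie n g) (V : lmodType K) := Representation {
  rep_rho : extpow n.-1 g -> {linear V -> V};
  rep_rho_linear : forall (a : K) (X Y : extpow n.-1 g) (v : V),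
    rep_rho (a *: X + Y) v = a *: rep_rho X v + rep_rho Y v;
  rep_beta : {linear V -> V};
  rep_beta_bij : bijective rep_beta;
  rep_equivariant : forall (X : extpow n.-1 g) (v : V),
    rep_rho (alphaT A X) (rep_beta v) = rep_beta (rep_rho X v);
  rep_commutator : forall (X Y : extpow n.-1 g) (v : V),
    rep_rho (alphaT A X) (rep_rho Y v) - rep_rho (alphaT A Y) (rep_rho X v) =
    rep_rho (brF A X Y) (rep_beta v);
  rep_bracket : forall (x : 'I_n.-2 -> g) (y : 'I_n -> g) (v : V),
    rep_rho (wedge (snoc (hl_alpha A \o x) (hl_br A (wedge y)))) (rep_beta v) =
    \sum_(i < n) (-1) ^+ (n - i.+1) *:
      rep_rho (wedge (omit i (hl_alpha A \o y)))
              (rep_rho (wedge (snoc x (y i))) v)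
}.

Section Cochains.
Variables (K : fieldType) (n : nat) (g V : lmodType K) (p : nat).

Local Notation W := (extpow n.-1 g).
Local Notation cfun := (('I_p.-1 -> W) -> g -> V).

(* The last clause is empty for p = 1. For p >= 2 it expresses total
   skew-symmetry in the n arguments x_(p-1)^1, ..., x_(p-1)^(n-1), z. *)
Definition is_cochain (f : cfun) : Prop :=
  [/\ forall z, multilinear (fun X => f X z),
      forall X (a : K) (u v : g), f X (a *: u + v) = a *: f X u + f X v
    & forall (l : 'I_p.-1) (X : 'I_p.-1 -> W) (x x' : 'I_n.-1 -> g) (z z' : g)
        (s : 'S_n),
        l.+1 = p.-1 -> snoc x' z' = snoc x z \o s ->
        f (upd X l (wedge x')) z' = (-1) ^+ s *: f (upd X l (wedge x)) z].

Definition cochain_pred : {pred cfun} := fun f => `[< is_cochain f >].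

Fact cochain_submod_closed : submod_closed cochain_pred.
Proof.
split=> [|a f h /asboolP[f1 f2 f3] /asboolP[h1 h2 h3]]; apply/asboolP.
  split=> [z i X a u v|X a u v|l X x x' z z' s _ _]; 
    by rewrite /= -[(0 : cfun) _ _]/(0 : V) scaler0 // addr0.
have E X z : (a *: f + h) X z = a *: f X z + h X z by [].
split=> [z i X b u v|X b u v|l X x x' z z' s lp sx]; rewrite !E.
- rewrite [f _ _]f1 [h _ _]h1 !scalerDr !scalerA addrACA.
  by rewrite [a * b]mulrC.
- by rewrite f2 h2 !scalerDr !scalerA addrACA [a * b]mulrC.
- by rewrite (f3 _ _ _ _ _ _ _ lp sx) (h3 _ _ _ _ _ _ _ lp sx)
             scalerDr !scalerA mulrC.
Qed.

HB.instance Definition _ :=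
  GRing.isSubmodClosed.Build K cfun cochain_pred cochain_submod_closed.

Record cochain := Cochain { cochain_fun :> cfun; _ : cochain_fun \in cochain_pred }.

HB.instance Definition _ := [isSub for cochain_fun].
HB.instance Definition _ := [Choice of cochain by <:].
HB.instance Definition _ := [SubChoice_isSubLmodule of cochain by <:].

Lemma cochainP (f : cochain) : is_cochain f.
Proof. by case: f => f /= /asboolP. Qed.

Lemma cochain_linE (a : K) (f h : cochain) X z :
  (a *: f + h) X z = a *: f X z + h X z.
Proof. by []. Qed.

Lemma cochain0E X z : (0 : cochain) X z = 0.
Proof. by []. Qed.

End Cochains.
Arguments cochain {K} n g V p.

(* The value of the coboundary of f, of degree q = p + 1, on the decomposable
   X_1, ..., X_q with X_i = x_i^1 /\ ... /\ x_i^(n-1), and z. Indices start at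
   0 here, so that i stands for the index i + 1 of the usual formula. *)
Definition coboundary_formula (K : fieldType) (n : nat) (g : lmodType K)
    (A : nHomLie n g) (V : lmodType K) (R : representation A V) (p : nat)
    (f : cochain n g V p.+1) (x : 'I_p.+1 -> 'I_n.-1 -> g) (z : g) : V :=
  let X := fun i => wedge (x i) in
  let av := hl_alphaV A in
  let aV := alphaTV A in
  let beta := rep_beta R in
  let rho := rep_rho R in
  \sum_(i < p.+1) \sum_(k < p.+1 | (i < k)%N)
    (-1) ^+ i.+1 *: beta (f
      (omit i (upd (aV \o X) k (brF A (aV (aV (X i))) (aV (aV (X k)))))) (av z))
  + \sum_(i < p.+1)
    (-1) ^+ i.+1 *: beta (f
      (omit i (aV \o X)) (act A (aV (aV (X i))) (av (av z))))
  + \sum_(i < p.+1)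
    (-1) ^+ i.+2 *: rho (X i) (f (omit i (aV \o X)) (av z))
  + \sum_(i < n.-1)
    (-1) ^+ (n + p.+1 - i.+1 + 1) *:
      rho (wedge (snoc (omit i (x ord_max)) z))
          (f (omit ord_max (aV \o X)) (av (x ord_max i))).

(* Main.v *)
(* Dividing the bracket by alpha and the action by beta turns the n-Hom-Lie
   algebra and its representation into an ordinary n-Lie algebra g and
   representation V, and delta f = beta d(f o alpha^-1) where d is the coboundary
   of the untwisted data; as d commutes with alpha and beta, it suffices that
   d d = 0.  There, W = wedge^(n-1) g is a left Leibniz algebra, Hom(g, V) is a
   bimodule over it, and d is the Loday-Pirashvili coboundary.  Writing i_Y for
   the insertion of Y as first argument and L_Y for the Lie derivative, Cartan's
   formula i_Y d = L_Y - d i_Y gives L_Y d = d L_Y and then d d = 0 by induction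
   on the number of arguments; skew-symmetry of d f in the last n arguments is
   proved by the same recursion. *)
Require Import Defs.
From HB Require Import structures.
From mathcomp Require Import all_boot all_order all_algebra.
From mathcomp Require Import perm boolp functions.

Set Implicit Arguments.
Unset Strict Implicit.
Unset Printing Implicit Defensive.

Import GRing.Theory.
Local Open Scope ring_scope.

(** * Tuples and multilinear maps *)

Section Tuples.
Variables (T : Type) (k : nat).
Implicit Types (x : 'I_k -> T) (u v : T).

Lemma updC x (i j : 'I_k) u v :
  i != j -> upd (upd x i u) j v = upd (upd x j v) i u.
Proof.
move=> ij; apply/funext => m; rewrite /upd.
by case: (eqVneq m j) => // ->; rewrite [j == i]eq_sym (negbTE ij).
Qed.

Lemma upd_upd x i u v : upd (upd x i u) i v = upd x i v.
Proof. by apply/funext => m; rewrite /upd; case: (m == i). Qed.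

Lemma upd_same x i u : upd x i u i = u.
Proof. by rewrite /upd eqxx. Qed.

Lemma upd_other x (i j : 'I_k) u : j != i -> upd x i u j = x j.
Proof. by rewrite /upd => /negbTE ->. Qed.

Lemma upd_perm x (s : 'S_k) j u : upd (x \o s) j u = upd x (s j) u \o s.
Proof. by apply/funext => i; rewrite /upd /= (inj_eq perm_inj). Qed.

(** Arguments of cochains are consed at the front because the Cartan recursion peels off the first
    one; [snoc] remains for the last entry of a bracket. *)
Definition fcons u x : 'I_k.+1 -> T := fun i => oapp x u (unlift ord0 i).

Lemma fcons0 u x : fcons u x ord0 = u.
Proof. by rewrite /fcons unlift_none. Qed.

Lemma fconsS u x i : fcons u x (lift ord0 i) = x i.
Proof. by rewrite /fcons liftK. Qed.

Lemma fcons_omit (x : 'I_k.+1 -> T) : fcons (x ord0) (omit ord0 x) = x.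
Proof. by apply/funext => i; rewrite /fcons /omit; case: unliftP => [j|] ->. Qed.

Lemma omit_fcons0 u x : omit ord0 (fcons u x) = x.
Proof. by apply/funext => i; rewrite /omit fconsS. Qed.

Lemma upd_fcons0 u x v : upd (fcons u x) ord0 v = fcons v x.
Proof.
apply/funext => i; rewrite /upd; case: (unliftP ord0 i) => [j|] ->.
  by rewrite eq_sym (negbTE (neq_lift _ _)) !fconsS.
by rewrite eqxx fcons0.
Qed.

Lemma upd_fconsS u x i v : upd (fcons u x) (lift ord0 i) v = fcons u (upd x i v).
Proof.
apply/funext => j; rewrite /upd; case: (unliftP ord0 j) => [j'|] ->.
  by rewrite (inj_eq lift_inj) !fconsS.
by rewrite (negbTE (neq_lift _ _)) !fcons0.
Qed.

Lemma snoc_widen (y : 'I_k -> T) z (i : 'I_k) :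
  @snoc k.+1 T y z (widen_ord (leqnSn k) i) = y i.
Proof. by rewrite /snoc /= valK. Qed.

Lemma snoc_max (y : 'I_k -> T) z : @snoc k.+1 T y z ord_max = z.
Proof. by rewrite /snoc insubF //= ltnn. Qed.

Lemma snoc_eta (u : 'I_k.+1 -> T) :
  @snoc k.+1 T (fun i => u (widen_ord (leqnSn k) i)) (u ord_max) = u.
Proof.
apply/funext => i; rewrite /snoc; case: insubP => [j _ ji|] /=.
  by congr u; apply: val_inj.
rewrite -leqNgt => ki; congr u; apply: val_inj => /=.
by apply/eqP; rewrite eqn_leq ki -ltnS ltn_ord.
Qed.

Lemma upd_snoc_widen (y : 'I_k -> T) z (i : 'I_k) u :
  upd (@snoc k.+1 T y z) (widen_ord (leqnSn k) i) u = @snoc k.+1 T (upd y i u) z.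
Proof.
apply/funext => j; rewrite /upd /snoc -val_eqE /=.
case: insubP => [j' _ ej|] /=; first by rewrite -ej.
by case: eqP => // ->; rewrite ltn_ord.
Qed.

Lemma upd_snoc_max (y : 'I_k -> T) z u :
  upd (@snoc k.+1 T y z) ord_max u = @snoc k.+1 T y u.
Proof.
apply/funext => j; rewrite /upd /snoc -val_eqE /=.
case: insubP => [j' _ ej|] /=; first by rewrite -ej (ltn_eqF (ltn_ord j')).
case: eqP => // + /negP[]; have := ltn_ord j.
by rewrite ltnS leq_eqVlt => /predU1P[].
Qed.

End Tuples.

Lemma snoc_comp (T T' : Type) k (h : T -> T') (y : 'I_k.-1 -> T) z :
  h \o snoc y z = snoc (h \o y) (h z).
Proof. by apply/funext => i; rewrite /snoc /=; case: insub. Qed.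

Lemma omit_fconsS (T : Type) k (u : T) (x : 'I_k.+1 -> T) i :
  omit (lift ord0 i) (fcons u x) = fcons u (omit i x).
Proof.
apply/funext => j; rewrite /omit; case: (unliftP ord0 j) => [j'|] ->.
  rewrite fconsS -[RHS](fconsS u); congr fcons; apply: val_inj => /=.
  by rewrite !bumpS.
rewrite fcons0 -[RHS](fcons0 u x); congr fcons; apply: val_inj => /=.
by rewrite /bump.
Qed.

Lemma omit_upd (T : Type) k (u : T) (x : 'I_k -> T) i : omit i (upd x i u) = omit i x.
Proof. by apply/funext => j; rewrite /omit upd_other // eq_sym neq_lift. Qed.

Lemma omit_upd_lift (T : Type) k (u : T) (x : 'I_k -> T) i j :
  omit i (upd x (lift i j) u) = upd (omit i x) j u.
Proof. by apply/funext => m; rewrite /omit /upd (inj_eq lift_inj). Qed.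

(** [s] maps the complement of [i] onto the complement of [s i]; the permutation [t] is [s] read
    there through [lift]. *)
Lemma lift_perm_surj k (s : 'S_k.+1) i : exists t, s = lift_perm i (s i) t.
Proof.
have Q j : s (lift i j) != s i by rewrite (inj_eq perm_inj) eq_sym neq_lift.
have lt j : {j' | s (lift i j) = lift (s i) j'}.
  by case: (unliftP (s i) (s (lift i j))) (Q j) => [j' ->|->];
    [exists j' | rewrite eqxx].
have tinj : injective (fun j => sval (lt j)).
  move=> j1 j2 /= e; apply: (@lift_inj _ i); apply: (@perm_inj _ s).
  by rewrite [LHS](svalP (lt j1)) [RHS](svalP (lt j2)) e.
exists (perm tinj); apply/permP => j; case: (unliftP i j) => [j'|] ->.
  by rewrite lift_perm_lift permE; exact: (svalP (lt j')).
by rewrite lift_perm_id.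
Qed.

(** Supplies the sign bookkeeping for [rho_sum]: the parity of [t] differs from that of [s] by the
    parities of [i] and [s i]. *)
Lemma omit_perm (T : Type) k (u : 'I_k.+1 -> T) (s : 'S_k.+1) i : exists t : 'S_k,
  omit i (u \o s) = omit (s i) u \o t /\ s = odd i (+) odd (s i) (+) t :> bool.
Proof.
have [t st] := lift_perm_surj s i; exists t; split.
  by apply/funext => j; rewrite /omit /= {1}st lift_perm_lift.
by rewrite {1}st odd_lift_perm.
Qed.

Lemma scaler_addB (K : fieldType) (V : lmodType K) (a : K) (x x' y y' : V) :
  a *: x + x' - (a *: y + y') = a *: (x - y) + (x' - y').
Proof. by rewrite opprD addrACA -scalerBr. Qed.

Lemma omit_snoc_max (T : Type) k (y : 'I_k -> T) z :
  omit ord_max (@snoc k.+1 T y z) = y.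
Proof.
apply/funext => i; rewrite /omit -[RHS](snoc_widen y z).
by congr (@snoc k.+1 T y z _); apply: val_inj; rewrite /= /bump leqNgt ltn_ord.
Qed.

Lemma omit_snoc_widen (T : Type) k (y : 'I_k.+1 -> T) z (i : 'I_k.+1) :
  omit (widen_ord (leqnSn k.+1) i) (@snoc k.+2 T y z) = @snoc k.+1 T (omit i y) z.
Proof.
apply/funext => j; rewrite /omit /snoc /= /bump.
have ik : (i <= k)%N by rewrite -ltnS.
have jk : (j <= k)%N by rewrite -ltnS.
case: insubP => [j' _ ej'|nj']; case: insubP => [j'' _ ej''|nj''] //=.
- by congr y; apply: val_inj; rewrite /= /bump ej' ej''.
- have ejk : j = k :> nat by apply/eqP; rewrite eqn_leq jk leqNgt.
  by have := ltn_ord j'; rewrite ej' ejk ik ltnn.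
- case/negP: nj'; rewrite ltnS -ej''; case: (i <= j'')%N; first exact: ltn_ord.
  exact: ltnW (ltn_ord j'').
Qed.

(** * Multilinear maps: permutations, contraction, derivations *)

Section MultilinearTheory.
Variables (K : fieldType) (U V : lmodType K).

Section Multilinear.
Variables (k : nat) (f : ('I_k -> U) -> V).
Hypothesis f_lin : multilinear f.

Lemma multilinearD x i u v : f (upd x i (u + v)) = f (upd x i u) + f (upd x i v).
Proof. by rewrite -[u in LHS]scale1r f_lin scale1r. Qed.

Lemma multilinear0 x i : f (upd x i 0) = 0.
Proof. by have := f_lin i x (-1) 0 0; rewrite scaler0 addr0 scaleN1r addNr. Qed.

Lemma multilinearB x i u v : f (upd x i (u - v)) = f (upd x i u) - f (upd x i v).
Proof. by rewrite addrC -scaleN1r f_lin scaleN1r addrC. Qed.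

Lemma multilinear_sum x i (I : finType) (F : I -> U) :
  f (upd x i (\sum_j F j)) = \sum_j f (upd x i (F j)).
Proof.
by apply: (big_morph (fun u => f (upd x i u)) (multilinearD x i) (multilinear0 x i)).
Qed.

Lemma alternating_perm x (s : 'S_k) : alternating f -> f (x \o s) = (-1) ^+ s *: f x.
Proof.
move=> f_alt.
have swap y i j : i != j -> f (y \o tperm i j) = - f y.
  move=> ij; have yij : y \o tperm i j = upd (upd y i (y j)) j (y i).
    apply/funext => m; rewrite /upd /=.
    by case: tpermP => [->|->|/eqP/negbTE -> /eqP/negbTE -> //];
       rewrite ?eqxx // (negbTE ij).
  have y_id : y = upd (upd y i (y i)) j (y j).
    by apply/funext => m; rewrite /upd; do 2?[case: eqP => [->//|_]].
  have alt w : f (upd (upd y i w) j w) = 0.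
    by apply: (f_alt _ i j) => //; rewrite upd_same upd_other // upd_same.
  (* Polarization: of the four terms of the expansion at [y i + y j] only the two mixed ones
     survive, so they are opposite. *)
  have := alt (y i + y j); rewrite multilinearD !(updC _ _ _ ij) !multilinearD.
  rewrite -!(updC _ _ _ ij) !alt add0r addr0 -yij -y_id.
  by move/eqP; rewrite addr_eq0 => /eqP.
case: (prod_tpermP s) => ts -> {s}; elim: ts x => [|[i j] ts IH] x /=.
  move=> _; rewrite big_nil odd_perm1 scale1r; congr f.
  by apply/funext => m; rewrite /= perm1.
case/andP => ij dts; rewrite big_cons odd_mul_tperm /= ij.
have -> : x \o (tperm i j * \prod_(t <- ts) tperm t.1 t.2)%g
  = (x \o (\prod_(t <- ts) tperm t.1 t.2)%g) \o tperm i j.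
  by apply/funext => m; rewrite /= permM.
by rewrite swap // IH // signr_addb expr1 mulN1r scaleNr.
Qed.

End Multilinear.

(** The interior product i_Y of the Cartan calculus. *)
Definition ctr k (Y : U) (F : ('I_k.+1 -> U) -> V) : ('I_k -> U) -> V :=
  fun X => F (fcons Y X).

(** Turns multilinearity into a recursive condition, on which the inductions on the number of
    arguments run. *)
Lemma multilinear_fcons k (F : ('I_k.+1 -> U) -> V) :
  multilinear F <->
  (forall X, linear (fun Y => F (fcons Y X))) /\ (forall Y, multilinear (ctr Y F)).
Proof.
split=> [FL|[F0 FS] i x a u v].
  split=> [X a u v|Y i x a u v].
    by have := FL ord0 (fcons 0 X) a u v; rewrite !upd_fcons0.
  by have := FL (lift ord0 i) (fcons Y x) a u v; rewrite !upd_fconsS.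
rewrite -(fcons_omit x); case: (unliftP ord0 i) => [j|] ->.
  by rewrite !upd_fconsS; exact: FS.
by rewrite !upd_fcons0; exact: F0.
Qed.

(** The action on multilinear maps of the derivation of the tensor algebra induced by [a]. *)
Definition derive k (a : U -> U) (F : ('I_k -> U) -> V) (x : 'I_k -> U) : V :=
  \sum_j F (upd x j (a (x j))).

Lemma derive_multilinear k (a : U -> U) (F : ('I_k -> U) -> V) :
  linear a -> multilinear F -> multilinear (derive a F).
Proof.
move=> a_lin F_lin i x c u v; rewrite /derive scaler_sumr -big_split /=.
apply: eq_bigr => j _; have [->|ji] := eqVneq j i.
  by rewrite !upd_upd !upd_same a_lin F_lin.
by rewrite !(upd_other _ _ ji) !(@updC _ _ _ i j) 1?eq_sym // F_lin.
Qed.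

(** In a composite, the terms changing two different slots are symmetric in [a] and [b] and cancel;
    the diagonal terms leave the commutator. Its order is reversed because [derive] acts by
    precomposition. *)
Lemma derive_comm k (a b c : U -> U) (F : ('I_k -> U) -> V) x :
  multilinear F -> (forall u, c u = a (b u) - b (a u)) ->
  derive b (derive a F) x - derive a (derive b F) x = derive c F x.
Proof.
move=> F_lin abc.
have split_diag a' b' : derive b' (derive a' F) x =
    derive (a' \o b') F x +
    \sum_i \sum_(j | j != i) F (upd (upd x i (b' (x i))) j (a' (x j))).
  rewrite /derive -big_split; apply: eq_bigr => i _ /=.
  rewrite (bigD1 i) //= upd_upd upd_same; congr (_ + _).
  by apply: eq_bigr => j ji; rewrite upd_other.
rewrite !split_diag [X in _ - (_ + X)](exchange_big_dep predT) //=.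
have -> : \sum_j \sum_(i | j != i) F (upd (upd x i (a (x i))) j (b (x j))) =
          \sum_i \sum_(j | j != i) F (upd (upd x i (b (x i))) j (a (x j))).
  apply: eq_bigr => i _; rewrite (eq_bigl (fun j => j != i)); last first.
    by move=> j; rewrite eq_sym.
  by apply: eq_bigr => j ji; rewrite updC.
rewrite opprD addrACA subrr addr0 /derive -sumrB; apply: eq_bigr => i _.
by rewrite -multilinearB // /= abc.
Qed.

Lemma derive_perm k (a : U -> U) (F : ('I_k -> U) -> V) (c : K) (s : 'S_k) :
  (forall x, F (x \o s) = c *: F x) ->
  forall x, derive a F (x \o s) = c *: derive a F x.
Proof.
move=> Fs x; rewrite /derive scaler_sumr [RHS](reindex_inj (@perm_inj _ s)) /=.
by apply: eq_bigr => j _; rewrite upd_perm Fs.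
Qed.

End MultilinearTheory.

(** * The Loday-Pirashvili complex *)

Section LeibnizComplex.
Variables (K : fieldType) (L M : lmodType K).
Variables (br : L -> L -> L) (l t : L -> M -> M).

(** The Lie derivative L_Y of the Cartan calculus. *)
Definition lie (Y : L) k (F : ('I_k -> L) -> M) (X : 'I_k -> L) : M :=
  l Y (F X) - derive (br Y) F X.

(* [l] is the left action and [t] the sum of the left and right actions of a
   left Leibniz algebra [L] on the bimodule [M]; this is the Loday-Pirashvili
   coboundary. *)
Definition leibniz_d k (F : ('I_k -> L) -> M) (X : 'I_k.+1 -> L) : M :=
  \sum_(i < k.+1) (-1) ^+ i.+1 *:
     (\sum_(j < k.+1 | (i < j)%N) F (omit i (upd X j (br (X i) (X j))))
      - l (X i) (F (omit i X)))
  + (-1) ^+ k.+1 *: t (X ord_max) (F (omit ord_max X)).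

Hypothesis br_linl : forall Y, linear (br^~ Y).
Hypothesis br_linr : forall X, linear (br X).
Hypothesis br_leibniz :
  forall X Y Z, br (br X Y) Z = br X (br Y Z) - br Y (br X Z).
Hypothesis l_linl : forall m, linear (l^~ m).
Hypothesis l_linr : forall X, linear (l X).
Hypothesis t_linl : forall m, linear (t^~ m).
Hypothesis t_linr : forall X, linear (t X).
(** With r = t - l the right action, these three are the bimodule axioms of a left Leibniz algebra:
    l_[X,Y] = [l_X, l_Y], r_[X,Y] = [l_X, r_Y] and r_Y (l_X + r_X) = 0. *)
Hypothesis l_br : forall X Y m, l (br X Y) m = l X (l Y m) - l Y (l X m).
Hypothesis t_br : forall X Y m, t (br X Y) m = l X (t Y m) - t Y (l X m).
Hypothesis t_t : forall X Y m, t Y (t X m) = l Y (t X m).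

Let lB X m m' : l X (m - m') = l X m - l X m'.
Proof. by rewrite addrC -scaleN1r l_linr scaleN1r addrC. Qed.

Let tB X m m' : t X (m - m') = t X m - t X m'.
Proof. by rewrite addrC -scaleN1r t_linr scaleN1r addrC. Qed.

Lemma lie_linear Y k (a : K) (F G : ('I_k -> L) -> M) X :
  lie Y (a *: F + G) X = a *: lie Y F X + lie Y G X.
Proof.
have E Z : (a *: F + G) Z = a *: F Z + G Z by [].
rewrite /lie /derive E l_linr scalerBr addrACA -opprD scaler_sumr -big_split /=.
by congr (_ - _); apply: eq_bigr.
Qed.

Lemma lieB Y k (F G : ('I_k -> L) -> M) X : lie Y (F - G) X = lie Y F X - lie Y G X.
Proof. by rewrite [F - G]addrC -[- G]scaleN1r lie_linear scaleN1r addrC. Qed.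

Lemma leibniz_d_linear k (a : K) (F G : ('I_k -> L) -> M) X :
  leibniz_d (a *: F + G) X = a *: leibniz_d F X + leibniz_d G X.
Proof.
have E Z : (a *: F + G) Z = a *: F Z + G Z by [].
rewrite /leibniz_d E t_linr !scalerDr addrACA; congr (_ + _); last first.
  by rewrite !scalerA mulrC.
rewrite scaler_sumr -big_split /=; apply: eq_bigr => i _.
rewrite scalerA [a * _]mulrC -scalerA -scalerDr; congr (_ *: _).
rewrite E l_linr scalerBr addrACA -opprD scaler_sumr -big_split /=.
by congr (_ - _); apply: eq_bigr.
Qed.

Lemma leibniz_dB k (F G : ('I_k -> L) -> M) X :
  leibniz_d (F - G) X = leibniz_d F X - leibniz_d G X.
Proof. by rewrite [F - G]addrC -[- G]scaleN1r leibniz_d_linear scaleN1r addrC. Qed.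

Lemma leibniz_d0 (F : ('I_0 -> L) -> M) Y X :
  leibniz_d F (fcons Y X) = l Y (F X) - t Y (F X).
Proof.
rewrite /leibniz_d !big_ord_recl !big_ord0 /= expr1 big_mkcond big_ord_recl big_ord0 /=.
have -> : ord_max = ord0 :> 'I_1 by apply: val_inj.
by rewrite fcons0 omit_fcons0 !addr0 sub0r scaleN1r opprK scaleN1r.
Qed.

(* Cartan's formula [i_Y d + d i_Y = lie Y]. *)
Lemma leibniz_d_fcons k (F : ('I_k.+1 -> L) -> M) Y X :
  leibniz_d F (fcons Y X) = lie Y F X - leibniz_d (ctr Y F) X.
Proof.
rewrite /leibniz_d big_ord_recl expr1 scaleN1r opprB -addrA; congr (_ + _).
  rewrite fcons0 omit_fcons0 /lie /derive; congr (_ - _).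
  rewrite big_mkcond big_ord_recl /= add0r; apply: eq_bigr => j _.
  by rewrite upd_fconsS omit_fcons0 fconsS.
have max : ord_max = lift ord0 ord_max :> 'I_k.+2 by apply: val_inj.
rewrite max omit_fconsS fconsS opprD; congr (_ + _); last first.
  by rewrite [(-1) ^+ _.+2]exprS mulN1r scaleNr.
rewrite -sumrN; apply: eq_bigr => i _; rewrite fconsS omit_fconsS /=.
rewrite [(-1) ^+ _.+2]exprS mulN1r scaleNr; congr (- (_ *: (_ - _))).
rewrite big_mkcond big_ord_recl /= add0r -big_mkcond /=.
by apply: eq_bigr => j _; rewrite fconsS upd_fconsS omit_fconsS.
Qed.

(** The Cartan relation i_Y L_X = L_X i_Y - i_[X,Y]: the last term is the summand of [derive] at the
    first slot. *)
Lemma lie_fcons k (F : ('I_k.+1 -> L) -> M) X Y Z :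
  lie X F (fcons Y Z) = lie X (ctr Y F) Z - ctr (br X Y) F Z.
Proof.
rewrite /lie /derive big_ord_recl upd_fcons0 fcons0 opprD [- _ - _]addrC addrA.
congr (_ - _ - _); apply: eq_bigr => j _.
by rewrite upd_fconsS fconsS.
Qed.

Lemma lie_multilinear Y k (F : ('I_k -> L) -> M) :
  multilinear F -> multilinear (lie Y F).
Proof.
move=> FL i x a u v; rewrite /lie FL l_linr (derive_multilinear (br_linr Y) FL).
by rewrite scaler_addB.
Qed.

Lemma lie_linearl k (F : ('I_k -> L) -> M) X :
  multilinear F -> linear (fun Y => lie Y F X).
Proof.
move=> FL a u v; rewrite /lie /derive l_linl scalerBr addrACA -opprD scaler_sumr.
rewrite -big_split /=; congr (_ - _); apply: eq_bigr => j _.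
by rewrite br_linl FL.
Qed.

(** The mixed terms, where one element acts on the value and the other on an argument, are symmetric
    in [X] and [Y] and cancel. What is left is [l_br] on values and [derive_comm] on arguments. *)
Lemma lie_comm k (F : ('I_k -> L) -> M) X Y Z : multilinear F ->
  lie X (lie Y F) Z - lie Y (lie X F) Z = lie (br X Y) F Z.
Proof.
move=> FL; pose T A B := \sum_j l B (F (upd Z j (br A (Z j)))).
have l_derive A B : l B (derive (br A) F Z) = T A B.
  apply: (big_morph (l B)) => [m m'|].
    by rewrite -[m]scale1r l_linr !scale1r.
  by have := lB B 0 0; rewrite !subrr.
have lie_lie A B : lie A (lie B F) Z =
    l A (l B (F Z)) + derive (br A) (derive (br B) F) Z - (T B A + T A B).
  rewrite [LHS]/lie {1}/lie lB l_derive.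
  have -> : derive (br A) (lie B F) Z = T A B - derive (br A) (derive (br B) F) Z.
    by rewrite /derive /lie -sumrB.
  by rewrite opprB addrACA -opprD.
rewrite !lie_lie [T Y X + _]addrC opprB addrA subrK opprD addrACA.
rewrite (derive_comm Z FL (br_leibniz Y X)) /lie l_br; congr (_ + _).
rewrite /derive -sumrN; apply: eq_bigr => j _.
(* [derive_comm] yields [br Y X] instead of [br X Y]. The bracket need not be skew, but by the
   Leibniz rule its left action is. *)
have -> : br (br Y X) (Z j) = 0 - br (br X Y) (Z j).
  by rewrite sub0r !br_leibniz opprB.
by rewrite multilinearB // multilinear0 // sub0r.
Qed.

(** Contracting both sides with the first argument and applying Cartan's formula and [lie_fcons]
    reduces the claim to [ctr Y F] and [lie_comm]; without arguments it is [l_br] and [t_br]. *)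
Lemma lie_d k (F : ('I_k -> L) -> M) X Z : multilinear F ->
  lie X (leibniz_d F) Z = leibniz_d (lie X F) Z.
Proof.
elim: k F X Z => [|k IH] F X Z FL; rewrite -(fcons_omit Z).
  set Y := Z ord0; set W := omit ord0 Z; rewrite lie_fcons.
  have dF A : ctr A (leibniz_d F) W = l A (F W) - t A (F W).
    by rewrite /ctr leibniz_d0.
  rewrite {1}/lie /derive big_ord0 subr0 !dF lB leibniz_d0 /lie /derive big_ord0.
  rewrite !subr0 l_br t_br [in X in _ - X]opprD.
  by rewrite [X in _ - X]addrACA -opprD subKr.
set Y := Z ord0; set W := omit ord0 Z; rewrite lie_fcons.
have /multilinear_fcons[_ FS] := FL.
have dF A : ctr A (leibniz_d F) = lie A F - leibniz_d (ctr A F).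
  by apply/funext => B; rewrite /ctr leibniz_d_fcons.
have lF : ctr Y (lie X F) = lie X (ctr Y F) - ctr (br X Y) F.
  by apply/funext => B; rewrite /ctr lie_fcons.
have dFW A B : ctr A (leibniz_d F) B = lie A F B - leibniz_d (ctr A F) B.
  by rewrite dF.
rewrite dFW dF lieB leibniz_d_fcons lF leibniz_dB IH // -lie_comm //.
move: (lie X (lie Y F) W) (lie Y (lie X F) W) => a c.
move: (leibniz_d (lie X (ctr Y F)) W) (leibniz_d (ctr (br X Y) F) W) => b e.
by rewrite !opprB addrC !addrA subrK [e + c]addrC.
Qed.

(** i_Y d d = L_Y d - d i_Y d = d L_Y - d (L_Y - d i_Y) = d d i_Y. In the base case the value is l_Z
    (t_Y m) - t_Z (t_Y m), which [t_t] kills. *)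
Theorem leibniz_dd k (F : ('I_k -> L) -> M) X : multilinear F ->
  leibniz_d (leibniz_d F) X = 0.
Proof.
elim: k F X => [|k IH] F X FL; rewrite -(fcons_omit X).
  set Y := X ord0; set W := omit ord0 X.
  rewrite leibniz_d_fcons lie_d // -(fcons_omit W) !leibniz_d0.
  set Z := W ord0; set E := omit ord0 W.
  rewrite /ctr !leibniz_d0 /lie /derive big_ord0 subr0 lB tB t_t.
  by rewrite [in X in _ - X]opprB addrA subrK subrr.
have /multilinear_fcons[_ FS] := FL.
have dF A : ctr A (leibniz_d F) = lie A F - leibniz_d (ctr A F).
  by apply/funext => B; rewrite /ctr leibniz_d_fcons.
by rewrite leibniz_d_fcons lie_d // dF leibniz_dB IH // subr0 subrr.
Qed.

Lemma leibniz_d_multilinear k (F : ('I_k -> L) -> M) :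
  multilinear F -> multilinear (leibniz_d F).
Proof.
elim: k F => [|k IH] F FL; apply/multilinear_fcons; split.
- move=> X a u v; rewrite !leibniz_d0 l_linl t_linl.
  by rewrite scaler_addB.
- by move=> Y [].
- have /multilinear_fcons[F0 _] := FL.
  move=> X a u v; rewrite !leibniz_d_fcons lie_linearl //.
  have -> : ctr (a *: u + v) F = a *: ctr u F + ctr v F.
    by apply/funext => Z; exact: F0.
  by rewrite leibniz_d_linear scaler_addB.
- have /multilinear_fcons[_ FS] := FL.
  move=> Y i x a u v; rewrite /ctr !leibniz_d_fcons.
  rewrite (lie_multilinear Y FL) (IH _ (FS Y)).
  by rewrite scaler_addB.
Qed.

End LeibnizComplex.

(** [s] pulls arguments back and [h] pushes values forward. Used with [s] the inverse of [alphaT]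
    and [h := twist]. *)
Lemma leibniz_d_natural (K : fieldType) (L M : lmodType K) (br : L -> L -> L)
    (l t : L -> M -> M) (s : L -> L) (h : {linear M -> M}) k
    (F : ('I_k -> L) -> M) X :
  (forall X Y, s (br X Y) = br (s X) (s Y)) ->
  (forall X m, h (l (s X) m) = l X (h m)) ->
  (forall X m, h (t (s X) m) = t X (h m)) ->
  h (leibniz_d br l t F (s \o X)) = leibniz_d br l t (fun Y => h (F (s \o Y))) X.
Proof.
move=> s_br h_l h_t; rewrite /leibniz_d linearD linearZ /= h_t.
congr (_ + _); rewrite linear_sum; apply: eq_bigr => i _.
rewrite linearZ /= linearB /= h_l linear_sum; congr (_ *: (_ - _)).
apply: eq_bigr => j _; rewrite -s_br.
by congr (h (F _)); rewrite -upd_comp.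
Qed.

(** * n-Lie algebras *)

Lemma linear_fun0 (K : fieldType) (U V : lmodType K) (f : U -> V) : linear f -> f 0 = 0.
Proof. by move=> fL; have := fL (-1) 0 0; rewrite scaler0 addr0 scaleN1r addNr. Qed.

Lemma linear_funD (K : fieldType) (U V : lmodType K) (f : U -> V) :
  linear f -> {morph f : u v / u + v}.
Proof. by move=> fL u v; rewrite -[u in LHS]scale1r fL scale1r. Qed.

(** * The module Hom(g, V), coefficients of the Leibniz complex *)

Section LMap.
Variables (K : fieldType) (U V : lmodType K).

Definition lmap_pred : {pred U -> V} := fun f => `[< linear f >].

Fact lmap_submod_closed : submod_closed lmap_pred.
Proof.
split=> [|c f h /asboolP fL /asboolP hL]; apply/asboolP => a u v.
  by rewrite -[RHS]/(a *: (0 : V) + 0) scaler0 addr0.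
have E w : (c *: f + h) w = c *: f w + h w by [].
by rewrite !E fL hL !scalerDr !scalerA addrACA [a * c]mulrC.
Qed.

HB.instance Definition _ :=
  GRing.isSubmodClosed.Build K (U -> V) lmap_pred lmap_submod_closed.

Record lmap := LMap { lmap_fun :> U -> V; _ : lmap_fun \in lmap_pred }.

HB.instance Definition _ := [isSub for lmap_fun].
HB.instance Definition _ := [Choice of lmap by <:].
HB.instance Definition _ := [SubChoice_isSubLmodule of lmap by <:].

Lemma lmap_linear (f : lmap) : linear f.
Proof. by case: f => f /= /asboolP. Qed.

HB.instance Definition _ (f : lmap) := GRing.isLinear.Build K U V *:%R f (lmap_linear f).

Lemma lmap_lin (f : lmap) (c : K) u v : f (c *: u + v) = c *: f u + f v.
Proof. exact: lmap_linear. Qed.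

Lemma lmapP (f h : lmap) : (forall u, f u = h u) -> f = h.
Proof. by move=> fh; apply: val_inj; apply/funext. Qed.

Definition mk_lmap (f : U -> V) (fL : linear f) : lmap :=
  @LMap f (introT (asboolP _) fL).

Lemma lmap_addE (f h : lmap) u : (f + h) u = f u + h u. Proof. by []. Qed.
Lemma lmap_oppE (f : lmap) u : (- f) u = - f u. Proof. by []. Qed.
Lemma lmap_scaleE (c : K) (f : lmap) u : (c *: f) u = c *: f u. Proof. by []. Qed.
Lemma lmap_sumE (I : Type) (r : seq I) (P : pred I) (F : I -> lmap) u :
  (\sum_(i <- r | P i) F i) u = \sum_(i <- r | P i) F i u.
Proof. by apply: (big_morph (fun h : lmap => h u)). Qed.

End LMap.

(** * Insertion of (n-1)-vectors into alternating n-ary maps *)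

Section Hook.
Variables (K : fieldType) (n : nat) (g V : lmodType K).
Variable Phi : ('I_n -> g) -> V.

(** The operation [act] is the case where [Phi] is the bracket; the other use is
    [Phi := rho_sum phi]. *)
Definition hook (X : extpow n.-1 g) (z : g) : V :=
  ext_lift (fun x => Phi (snoc x z)) X.

Hypotheses (Phi_lin : multilinear Phi) (Phi_alt : alternating Phi).

Let snoc_lin z : multilinear (fun x => Phi (snoc x z)).
Proof.
move=> i x a u v; have [j [_ ju _]] := snoc_upd g i.
by rewrite !ju Phi_lin.
Qed.

Let snoc_alt z : alternating (fun x => Phi (snoc x z)).
Proof.
move=> x i j ij xij.
have [i' [ii _ iE]] := snoc_upd g i; have [j' [jj _ jE]] := snoc_upd g j.
apply: (Phi_alt (i := i') (j := j')); rewrite ?iE ?jE //.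
by rewrite -val_eqE /= ii jj.
Qed.

Lemma hookE x z : hook (wedge x) z = Phi (snoc x z).
Proof. exact: ext_liftE (snoc_lin z) (snoc_alt z) x. Qed.

Lemma hook_linearl z : linear (hook^~ z).
Proof. move=> a X Y; exact: ext_lift_linear (snoc_lin z) (snoc_alt z) a X Y. Qed.

Lemma hook_linearr X : (0 < n)%N -> linear (hook X).
Proof.
move=> n0 a u v; elim/ext_ind: X => [|b x X IH].
  by rewrite !(linear_fun0 (hook_linearl _)) scaler0 addr0.
have [j jE] := snoc_last n0.
rewrite !hook_linearl IH !hookE (jE _ x 0 (a *: u + v)) Phi_lin.
by rewrite -!jE !scalerDr !scalerA addrACA [a * b]mulrC.
Qed.

End Hook.

Lemma wedge_perm (K : fieldType) (k : nat) (g : lmodType K) (x : 'I_k -> g)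
    (s : 'S_k) :
  wedge (x \o s) = (-1) ^+ s *: wedge x.
Proof.
exact: alternating_perm (@wedge_multilinear _ _ _) _ _ (@wedge_alternating _ _ _).
Qed.

(** Extends [brFE] to indecomposable [X], both sides being linear in [X]. *)
Lemma brF_derive (K : fieldType) (n : nat) (g : lmodType K) (A : nHomLie n g)
    (X : extpow n.-1 g) (y : 'I_n.-1 -> g) : (0 < n)%N ->
  brF A X (wedge y) = \sum_i wedge (upd (hl_alpha A \o y) i (act A X (y i))).
Proof.
move=> n0; elim/ext_ind: X => [|a x X IH].
  rewrite (linear_fun0 (brF_linearl A (wedge y) n0)) big1 // => i _.
  by rewrite (linear_fun0 (act_linearl A _)) multilinear0 //; exact: wedge_multilinear.
rewrite (brF_linearl A (wedge y) n0) IH brFE // scaler_sumr -big_split /=.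
by apply: eq_bigr => i _; rewrite (act_linearl A) actE wedge_multilinear.
Qed.

(** * The Leibniz algebra W and its bimodule Hom(g, V) for trivial twists *)

Section Untwisted.
Variables (K : fieldType) (m : nat) (g V : lmodType K).
Local Notation n := m.+2.
Local Notation W := (extpow n.-1 g).
Local Notation H := (lmap g V).
Variables (A : nHomLie n g) (R : representation A V).
Hypothesis alpha_id : hl_alpha A =1 id.
Hypothesis beta_id : rep_beta R =1 id.

Let rho (X : W) : {linear V -> V} := rep_rho R X.

Let alpha_comp k (x : 'I_k -> g) : hl_alpha A \o x = x.
Proof. by apply/funext => i /=; rewrite alpha_id. Qed.

Let alphaT_id X : alphaT A X = X.
Proof.
elim/ext_ind: X => [|a x X IH]; first by rewrite linear0.
by rewrite linearP /= IH alphaTE alpha_comp.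
Qed.

Definition nbr (u : 'I_n -> g) : g := hl_br A (wedge u).

Lemma nbr_multilinear : multilinear nbr.
Proof. by move=> i x a u v; rewrite /nbr wedge_multilinear linearP. Qed.

Lemma nbr_alternating : alternating nbr.
Proof. by move=> x i j ij xij; rewrite /nbr (wedge_alternating ij xij) linear0. Qed.

(** The fundamental identity for arbitrary [X]: [act A X] is a derivation of the bracket. *)
Lemma act_nbr X u : act A X (nbr u) = derive (act A X) nbr u.
Proof.
elim/ext_ind: X => [|a x X IH].
  rewrite (linear_fun0 (act_linearl A _)) /derive big1 // => i _.
  by rewrite (linear_fun0 (act_linearl A _)) multilinear0 //; exact: nbr_multilinear.
rewrite act_linearl IH actE.
have := hl_jacobi A x u; rewrite !alpha_comp -/(nbr u) => ->.
rewrite /derive scaler_sumr -big_split; apply: eq_bigr => i _ /=.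
by rewrite act_linearl nbr_multilinear actE.
Qed.

(** [brF] differentiates only the first n - 1 arguments, so the derivative in all n is corrected by
    its last term. *)
Lemma hook_brF (V' : lmodType K) (Phi : ('I_n -> g) -> V') X y z :
  multilinear Phi -> alternating Phi ->
  hook Phi (brF A X (wedge y)) z =
  derive (act A X) Phi (snoc y z) - Phi (snoc y (act A X z)).
Proof.
move=> PL PA; rewrite brF_derive // /derive [in RHS]big_ord_recr /=.
rewrite snoc_max upd_snoc_max addrK.
have hL := hook_linearl PL PA z.
rewrite (big_morph (hook Phi ^~ z) (linear_funD hL) (linear_fun0 hL)).
by apply: eq_bigr => i _; rewrite alpha_comp hookE // snoc_widen upd_snoc_widen.
Qed.

Lemma act_brF X Y z : act A (brF A X Y) z = act A X (act A Y z) - act A Y (act A X z).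
Proof.
elim/ext_ind: Y => [|a y Y IH].
  have act0 := linear_fun0 (act_linearl A _).
  rewrite (linear_fun0 (brF_linearr A X (isT : (0 < n)%N))) !act0.
  by rewrite (linear_fun0 (act_linearr A X (isT : (0 < n)%N))) subrr.
rewrite brF_linearr // !act_linearl act_linearr // IH scaler_addB.
congr (_ *: _ + _).
transitivity (derive (act A X) nbr (snoc y z) - nbr (snoc y (act A X z))).
  exact: hook_brF nbr_multilinear nbr_alternating.
by rewrite -act_nbr !actE.
Qed.

(** On decomposables [brF A X] is [derive (act A X)] of the wedge map, so [derive_comm] carries the
    commutator relation [act_brF] from g to W. *)
Lemma brF_leibniz X Y Z : brF A (brF A X Y) Z = brF A X (brF A Y Z) - brF A Y (brF A X Z).
Proof.
have n0 : (0 < n)%N by [].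
elim/ext_ind: Z => [|a z Z IH].
  by rewrite !(linear_fun0 (brF_linearr A _ n0)) subrr.
rewrite !(brF_linearr A _ n0) IH scaler_addB; congr (_ *: _ + _).
have D B u : brF A B (wedge u) = derive (act A B) (@wedge _ _ _) u.
  by rewrite brF_derive // /derive alpha_comp.
have DD B C : brF A B (derive (act A C) (@wedge _ _ _) z)
    = derive (act A C) (derive (act A B) (@wedge _ _ _)) z.
  rewrite (big_morph (brF A B) (linear_funD (brF_linearr A B n0))
     (linear_fun0 (brF_linearr A B n0))).
  by apply: eq_bigr => i _; rewrite D.
rewrite !D !DD; symmetry; apply: derive_comm; first exact: wedge_multilinear.
by move=> u; rewrite act_brF.
Qed.

Lemma rho_brF X Y v : rho (brF A X Y) v = rho X (rho Y v) - rho Y (rho X v).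
Proof. by rewrite /rho -[v in LHS](beta_id v) -rep_commutator !alphaT_id. Qed.

Lemma rho_linear v : linear (fun X => rho X v).
Proof. by move=> a X Y; rewrite /rho rep_rho_linear. Qed.

(* Without its term [i = n - 1] this is, up to sign, the last sum of the
   coboundary; that term makes it alternating in all [n] arguments. *)
Definition rho_sum (phi : H) (u : 'I_n -> g) : V :=
  \sum_(i < n) (-1) ^+ (n - i.+1) *: rho (wedge (omit i u)) (phi (u i)).

Lemma rho_sum_multilinear phi : multilinear (rho_sum phi).
Proof.
move=> i x a u v; rewrite /rho_sum scaler_sumr -big_split /=.
apply: eq_bigr => j _; rewrite scalerA mulrC -scalerA -scalerDr; congr (_ *: _).
case: (unliftP j i) => [i'|] ->; last by rewrite !upd_same !omit_upd !linearP.
by rewrite !omit_upd_lift !upd_other ?neq_lift // wedge_multilinear rho_linear.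
Qed.

Lemma rho_sum_linear a phi psi u :
  rho_sum (a *: phi + psi) u = a *: rho_sum phi u + rho_sum psi u.
Proof.
rewrite /rho_sum scaler_sumr -big_split /=; apply: eq_bigr => j _.
by rewrite scalerA mulrC -scalerA -scalerDr linearP.
Qed.

(** Reindexing by [s] sends the summand [i] to [s i]; the sign of [t] from [omit_perm] and the
    change of the alternating sign multiply to that of [s]. *)
Lemma rho_sum_perm phi u (s : 'S_n) : rho_sum phi (u \o s) = (-1) ^+ s *: rho_sum phi u.
Proof.
rewrite /rho_sum scaler_sumr [RHS](reindex_inj (@perm_inj _ s)) /=.
apply: eq_bigr => i _; have [t [-> st]] := omit_perm u s i.
rewrite wedge_perm -[(-1) ^+ t *: _]addr0 rho_linear (linear_fun0 (rho_linear _)) addr0.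
rewrite !scalerA; congr (_ *: _).
rewrite -signr_odd -[RHS]mulrC -[X in _ = X * _]signr_odd !oddB ?ltn_ord //=.
rewrite -!signr_addb st; congr (_ ^+ _).
by case: (odd i) (odd (s i)) (odd_perm t) (odd m) => [] [] [] [].
Qed.

(** Proved directly, since over an arbitrary field [rho_sum_perm] would not suffice in
    characteristic 2. Summands other than [i] and [j] contain a wedge with a repeated vector. *)
Lemma rho_sum_alternating phi : alternating (rho_sum phi).
Proof.
move=> u i j ij uij; rewrite /rho_sum (bigD1 i) //= (bigD1 j) 1?eq_sym //=.
rewrite big1 => [|k /andP[ki kj]]; last first.
  have lift_ex i0 : k != i0 -> {i' | i0 = lift k i'}.
    by case: (unliftP k i0) => [i' ->|->]; [exists i' | rewrite eqxx].
  have [[i' ki'] [j' kj']] : {i' | i = lift k i'} * {j' | j = lift k j'}.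
    by split; apply: lift_ex.
  rewrite (@wedge_alternating _ _ _ (omit k u) i' j').
  - by rewrite (linear_fun0 (rho_linear _)) scaler0.
  - by apply: contra_neq ij => e; rewrite ki' kj' e.
  by rewrite /omit -ki' -kj'.
(* As the transposition fixes [u], [omit_perm] makes [omit i u] a permutation of [omit j u], and the
   parities give the two remaining summands opposite signs. *)
have us : u \o tperm i j = u.
  by apply/funext => k /=; case: tpermP => [->|->|].
have [t [ot ts]] := omit_perm u (tperm i j) i; move: ot ts.
rewrite us tpermL odd_tperm ij => -> ts; rewrite addr0 uij.
rewrite wedge_perm -[(-1) ^+ t *: _]addr0 rho_linear (linear_fun0 (rho_linear _)) addr0.
rewrite scalerA -scalerDl -[X in X * _]signr_odd -[X in _ + X]signr_odd -signr_addb.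
rewrite !oddB ?ltn_ord //=; case: (odd i) (odd j) (odd_perm t) (odd m) ts => [] [] [] [] //= _;
by rewrite ?expr0 ?expr1 ?subrr ?addNr scale0r.
Qed.

Fact lact_linear X (phi : H) : linear (fun z => rho X (phi z) - phi (act A X z)).
Proof.
by move=> a u v; rewrite act_linearr // !lmap_lin linearP scaler_addB.
Qed.

Fact tact_linear X (phi : H) :
  linear (fun z => rho X (phi z) - hook (rho_sum phi) X z).
Proof.
move=> a u v; rewrite (hook_linearr (@rho_sum_multilinear phi)) //; last first.
  exact: rho_sum_alternating.
by rewrite lmap_lin linearP scaler_addB.
Qed.

Definition lact X (phi : H) : H := mk_lmap (@lact_linear X phi).
(** Left plus right action: the right action of [X] sends [phi] to the map z |->
    [phi (act A X z) - hook (rho_sum phi) X z]. *)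
Definition tact X (phi : H) : H := mk_lmap (@tact_linear X phi).

Lemma lactE X phi z : lact X phi z = rho X (phi z) - phi (act A X z).
Proof. by []. Qed.

Lemma tactE X phi z : tact X phi z = rho X (phi z) - hook (rho_sum phi) X z.
Proof. by []. Qed.

Lemma lact_linearl phi : linear (lact^~ phi).
Proof.
move=> a X Y; apply: lmapP => z; rewrite !(lmap_addE, lmap_scaleE, lactE).
by rewrite rho_linear act_linearl lmap_lin scaler_addB.
Qed.

Lemma lact_linearr X : linear (lact X).
Proof.
move=> a phi psi; apply: lmapP => z.
by rewrite !(lmap_addE, lmap_scaleE, lactE) linearP scaler_addB.
Qed.

Lemma tact_linearl phi : linear (tact^~ phi).
Proof.
move=> a X Y; apply: lmapP => z; rewrite !(lmap_addE, lmap_scaleE, tactE).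
rewrite rho_linear (hook_linearl (@rho_sum_multilinear phi)); last first.
  exact: rho_sum_alternating.
by rewrite scaler_addB.
Qed.

Lemma tact_wedge phi y z :
  tact (wedge y) phi z = rho (wedge y) (phi z) - rho_sum phi (snoc y z).
Proof.
by rewrite /= hookE //; [exact: rho_sum_multilinear|exact: rho_sum_alternating].
Qed.

Lemma tact_linearr X : linear (tact X).
Proof.
move=> a phi psi; elim/ext_ind: X => [|b y Y IH].
  by rewrite !(linear_fun0 (tact_linearl _)) scaler0 addr0.
rewrite !tact_linearl IH scalerDr !scalerA addrACA; congr (_ + _).
rewrite [a * b]mulrC -[(b * a) *: _]scalerA -scalerDr; congr (_ *: _).
apply: lmapP => z; rewrite lmap_addE lmap_scaleE !tact_wedge.
by rewrite rho_sum_linear lmap_addE lmap_scaleE linearP scaler_addB.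
Qed.

Lemma lact_brF X Y phi :
  lact (brF A X Y) phi = lact X (lact Y phi) - lact Y (lact X phi).
Proof.
have rhoB Z v w : rho Z (v - w) = rho Z v - rho Z w by rewrite linearB.
have phiB v w : phi (v - w) = phi v - phi w by rewrite linearB.
apply: lmapP => z; rewrite !(lmap_addE, lmap_oppE, lactE) rho_brF act_brF.
rewrite !rhoB phiB.
rewrite !opprB [RHS]addrACA !subrKA [LHS]addrACA [RHS]addrACA.
by congr (_ + _); rewrite addrC.
Qed.

(** In each summand the commutator of [rho X] with [rho] of the omitted tuple is [rho] of a [brF],
    which differentiates that tuple; the [act] term of [lact] differentiates the entry under
    [phi]. *)
Lemma rho_sum_lact X phi u :
  rho X (rho_sum phi u) - rho_sum (lact X phi) u =
  derive (act A X) (rho_sum phi) u.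
Proof.
rewrite /derive /rho_sum exchange_big linear_sum -sumrB /=.
apply: eq_bigr => i _; rewrite linearZ -scalerBr -scaler_sumr /=; congr (_ *: _).
rewrite (bigD1_ord i) //= omit_upd upd_same linearB /= opprB addrCA.
congr (_ + _); rewrite -rho_brF brF_derive // alpha_comp.
have rL := rho_linear (phi (u i)).
rewrite (big_morph (fun X => rho X (phi (u i))) (linear_funD rL) (linear_fun0 rL)).
by apply: eq_bigr => j _; rewrite omit_upd_lift upd_other // neq_lift.
Qed.

(** For decomposable [Y], [hook_brF] applied to [rho_sum phi] produces a derivative, which
    [rho_sum_lact] evaluates. *)
Lemma tact_brF X Y phi :
  tact (brF A X Y) phi = lact X (tact Y phi) - tact Y (lact X phi).
Proof.
apply: lmapP => z; elim/ext_ind: Y => [|a y Y IH].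
  rewrite (linear_fun0 (brF_linearr A X (isT : (0 < n)%N))).
  rewrite !(linear_fun0 (tact_linearl _)).
  by rewrite (linear_fun0 (lact_linearr _)) subrr.
rewrite brF_linearr // !tact_linearl lact_linearr.
move: IH; rewrite !(lmap_addE, lmap_oppE, lmap_scaleE) => ->.
rewrite scaler_addB; congr (_ *: _ + _).
transitivity (rho (brF A X (wedge y)) (phi z) -
   (derive (act A X) (rho_sum phi) (snoc y z) - rho_sum phi (snoc y (act A X z)))).
  congr (_ - _); apply: hook_brF; first exact: rho_sum_multilinear.
  exact: rho_sum_alternating.
rewrite -rho_sum_lact -[lact X _ z]/(rho X (tact _ _ z) - tact _ _ (act A X z)).
have rhoB Z v w : rho Z (v - w) = rho Z v - rho Z w by rewrite linearB.
rewrite !tact_wedge lactE !rhoB rho_brF.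
move: (rho X (rho _ _)) (rho _ (rho X _)) (rho X (rho_sum _ _)) => b d s.
move: (rho_sum (lact _ _) _) (rho_sum phi _) (rho _ (phi (act A X z))) => e f c.
rewrite !opprB -[RHS]addrA (addrCA e c) subrKA [LHS]addrACA [RHS]addrACA.
by congr (_ + _); rewrite (addrCA (- d)) (addrCA (- s)) [- d - s]addrC.
Qed.

(** The last summand of [rho_sum] is [rho (wedge x) (phi z)] and cancels; what remains is the last
    sum of the coboundary up to sign. *)
Lemma tact_wedge_sum phi x z : tact (wedge x) phi z =
  - \sum_(i < m.+1) (-1) ^+ (n - i.+1) *: rho (wedge (snoc (omit i x) z)) (phi (x i)).
Proof.
rewrite tact_wedge /rho_sum big_ord_recr /= snoc_max omit_snoc_max subnn.
rewrite expr0 scale1r opprD addrCA subrr addr0; congr (- _).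
by apply: eq_bigr => i _; rewrite omit_snoc_widen snoc_widen.
Qed.

(** This is where axiom (iii) of a representation enters: after exchanging the two sums, the inner
    one is its right-hand side for [omit i x] and the vector [phi (x i)]. *)
Lemma rho_sum_tact X phi u : rho_sum (tact X phi) u = tact X phi (nbr u).
Proof.
elim/ext_ind: X => [|a x X IH].
  rewrite (linear_fun0 (tact_linearl _)) /rho_sum big1 // => i _.
  by rewrite linear0 scaler0.
rewrite tact_linearl rho_sum_linear IH lmap_addE lmap_scaleE; congr (_ *: _ + _).
rewrite tact_wedge_sum /rho_sum.
under eq_bigr => i _ do rewrite tact_wedge_sum linearN linear_sum scalerN.
rewrite sumrN; congr (- _).
under eq_bigr => i _ do rewrite scaler_sumr.
rewrite exchange_big; apply: eq_bigr => i _ /=.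
have := rep_bracket R (omit i x) u (phi (x i)).
rewrite alpha_comp beta_id -/(nbr u) /rho => ->; rewrite scaler_sumr.
apply: eq_bigr => j _; rewrite alpha_comp linearZ /= !scalerA; congr (_ *: _).
exact: mulrC.
Qed.

(** With psi = [tact X phi], the two sides differ only in [hook (rho_sum psi) Y z] against
    [psi (act A Y z)], which [rho_sum_tact] identifies. *)
Lemma tact_tact X Y phi : tact Y (tact X phi) = lact Y (tact X phi).
Proof.
have hL z := hook_linearl (@rho_sum_multilinear (tact X phi))
  (@rho_sum_alternating (tact X phi)) z.
apply: lmapP => z; congr (_ - _); elim/ext_ind: Y => [|a y Y IH].
  by rewrite (linear_fun0 (act_linearl A _)) linear0 (linear_fun0 (hL z)).
rewrite act_linearl lmap_lin hL IH hookE; last 2 first.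
- exact: rho_sum_multilinear.
- exact: rho_sum_alternating.
by rewrite rho_sum_tact actE.
Qed.

(** The skew-symmetry clause of [is_cochain] in curried form: the n vectors are split between the
    last slot of [F] and the argument of its value. *)
Definition skew_last k (F : ('I_k -> W) -> H) : Prop :=
  forall (l : 'I_k) (X : 'I_k -> W) (x x' : 'I_n.-1 -> g) (z z' : g) (s : 'S_n),
    l.+1 = k -> snoc x' z' = snoc x z \o s ->
    F (upd X l (wedge x')) z' = (-1) ^+ s *: F (upd X l (wedge x)) z.

Definition nlie_d k (F : ('I_k -> W) -> H) : ('I_k.+1 -> W) -> H :=
  leibniz_d (brF A) lact tact F.

(** Slot [l] and the argument of the value form one map [Phi] of n vectors. The [brF] term in slot
    [l] and the [act] term of [lact] add up to [derive] of [Phi], which respects permutations; the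
    other terms leave these n vectors alone. *)
Lemma lie_skew Y k (F : ('I_k -> W) -> H) : multilinear F -> skew_last F ->
  skew_last (lie (brF A) lact Y F).
Proof.
move=> FL Fs l X x x' z z' s lk sx.
pose init (u : 'I_n -> g) (i : 'I_m.+1) := u (widen_ord (leqnSn m.+1) i).
have init_snoc w v : init (snoc w v) = w by apply/funext => i; exact: snoc_widen.
pose Phi (u : 'I_n -> g) := F (upd X l (wedge (init u))) (u ord_max).
have PhiE w v : Phi (snoc w v) = F (upd X l (wedge w)) v.
  by rewrite /Phi init_snoc snoc_max.
have Phi_perm u : Phi (u \o s) = (-1) ^+ s *: Phi u.
  by apply: Fs => //; rewrite !snoc_eta.
have lieE w v : lie (brF A) lact Y F (upd X l (wedge w)) v =
    rho Y (F (upd X l (wedge w)) v) - derive (act A Y) Phi (snoc w v)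
    - \sum_(j | j != l) F (upd (upd X j (brF A Y (X j))) l (wedge w)) v.
  rewrite /lie /derive lmap_addE lmap_oppE lmap_sumE lactE (bigD1 l) //=.
  rewrite big_ord_recr /= snoc_max upd_snoc_max PhiE upd_upd upd_same.
  rewrite brF_derive // multilinear_sum // lmap_sumE alpha_comp -!addrA -!opprD.
  congr (_ - _); rewrite addrCA -[RHS]addrA; congr (_ + _); last first.
    congr (_ + _); apply: eq_bigr => j jl.
    by rewrite upd_other // updC // eq_sym.
  by apply: eq_bigr => i _; rewrite snoc_widen upd_snoc_widen PhiE.
rewrite !lieE sx (derive_perm _ Phi_perm) !scalerBr -linearZ.
rewrite (Fs l X x x' z z' s) //; congr (_ - _ - _).
by rewrite scaler_sumr; apply: eq_bigr => j _; exact: Fs.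
Qed.

Lemma nlie_d_skew k (F : ('I_k -> W) -> H) : multilinear F -> skew_last F ->
  skew_last (nlie_d F).
Proof.
elim: k F => [|k IH] F FL Fs l X x x' z z' s lk sx.
  rewrite (ord1 l) -(fcons_omit X) !upd_fcons0 /nlie_d !leibniz_d0.
  set phi := F _.
  (* The first coboundary produces the skew-symmetry: it is a difference of two alternating maps of
     n vectors. *)
  have E w v : (lact (wedge w) phi - tact (wedge w) phi) v =
      rho_sum phi (snoc w v) - phi (nbr (snoc w v)).
    rewrite lmap_addE lmap_oppE lactE tact_wedge actE opprB addrC.
    by rewrite addrA subrK.
  rewrite !E sx rho_sum_perm scalerBr -linearZ; congr (_ - phi _).
  exact: alternating_perm nbr_multilinear _ _ nbr_alternating.
(* With at least two slots the last one is not the first, so contraction of the first slot leaves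
   the skew arguments intact. *)
case: (unliftP ord0 l) lk => [l'|] -> lk; last by case: lk.
have {}lk : l'.+1 = k.+1 by exact: succn_inj lk.
have /multilinear_fcons[_ FS] := FL.
rewrite -(fcons_omit X) !upd_fconsS /nlie_d !leibniz_d_fcons.
rewrite !lmap_addE !lmap_oppE scalerBr; congr (_ - _).
  exact: lie_skew FL Fs _ _ _ _ _ _ _ lk sx.
apply: (IH _ (FS _)) lk sx => l'' X' w w' v v' s' lk' sw.
by rewrite /ctr -!upd_fconsS; apply: Fs sw; congr _.+1; exact: lk'.
Qed.

Lemma nlie_d_multilinear k (F : ('I_k -> W) -> H) :
  multilinear F -> multilinear (nlie_d F).
Proof.
apply: leibniz_d_multilinear => *; first [exact: brF_linearl | exact: brF_linearr |
  exact: lact_linearl | exact: lact_linearr | exact: tact_linearl |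
  exact: tact_linearr].
Qed.

Lemma nlie_d_d k (F : ('I_k -> W) -> H) X : multilinear F -> nlie_d (nlie_d F) X = 0.
Proof.
apply: leibniz_dd => *; first [exact: brF_linearl | exact: brF_linearr |
  exact: brF_leibniz | exact: lact_linearl | exact: lact_linearr |
  exact: tact_linearl | exact: tact_linearr | exact: lact_brF |
  exact: tact_brF | exact: tact_tact].
Qed.

End Untwisted.

(** * Untwisting *)

(** Decomposables span each exterior power, so slots can be checked one at a time; this gives the
    uniqueness of the coboundary. *)
Lemma ext_multilinear_eq (K : fieldType) (k n : nat) (g V : lmodType K)
    (F G : ('I_k -> extpow n g) -> V) :
  multilinear F -> multilinear G ->
  (forall x : 'I_k -> 'I_n -> g,
     F (fun i => wedge (x i)) = G (fun i => wedge (x i))) -> F =1 G.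
Proof.
elim: k F G => [|k IH] F G FL GL FG X.
  have e : X = (fun i : 'I_0 => wedge (fun _ => 0)) by apply/funext => -[].
  by rewrite e; exact: FG.
have /multilinear_fcons[F0 FS] := FL; have /multilinear_fcons[G0 GS] := GL.
rewrite -(fcons_omit X); move: (X ord0) (omit ord0 X) => Y {}X.
elim/ext_ind: Y => [|a y Y IHY].
  by rewrite (linear_fun0 (F0 X)) (linear_fun0 (G0 X)).
rewrite F0 G0 IHY; congr (_ *: _ + _).
apply: (IH (ctr (wedge y) F) (ctr (wedge y) G)) => // x; rewrite /ctr.
suff -> : fcons (wedge y) (fun i => wedge (x i)) = (fun i => wedge (fcons y x i)).
  exact: FG.
by apply/funext => i; rewrite /fcons; case: unliftP.
Qed.

(** * The n-Lie algebra and representation underlying the twisted ones *)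

Section Twisted.
Variables (K : fieldType) (m : nat) (g V : lmodType K).
Local Notation n := m.+2.
Local Notation W := (extpow n.-1 g).
Local Notation H := (lmap g V).
Variables (A : nHomLie n g) (R : representation A V).
Variable betaV : {linear V -> V}.
Hypotheses (betaK : cancel (rep_beta R) betaV) (betaVK : cancel betaV (rep_beta R)).

Local Notation av := (hl_alphaV A).
Local Notation aV := (alphaTV A).

Lemma alphaV_br (u : 'I_n -> g) : av (hl_br A (wedge u)) = hl_br A (wedge (av \o u)).
Proof.
apply: (canLR (@hl_alphaK _ _ _ A)); rewrite hl_alpha_br; congr (hl_br A (wedge _)).
by apply/funext => i /=; rewrite hl_alphaVK.
Qed.

Lemma alpha_alphaV_comp k (u : 'I_k -> g) : av \o (hl_alpha A \o u) = u.
Proof. by apply/funext => i /=; rewrite hl_alphaK. Qed.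

Lemma alphaV_act X z : av (act A X z) = act A (aV X) (av z).
Proof.
elim/ext_ind: X => [|a x X IH].
  by rewrite linear0 !(linear_fun0 (act_linearl A _)) linear0.
rewrite alphaTV_linear !act_linearl hl_alphaV_linear IH alphaTVE !actE alphaV_br.
by rewrite snoc_comp.
Qed.

Lemma alphaV_brF X Y : aV (brF A X Y) = brF A (aV X) (aV Y).
Proof.
have n0 : (0 < n)%N by [].
elim/ext_ind: Y => [|a y Y IH].
  by rewrite linear0 !(linear_fun0 (brF_linearr A _ n0)) linear0.
rewrite alphaTV_linear !brF_linearr // alphaTV_linear IH alphaTVE !brF_derive //.
congr (_ *: _ + _); rewrite linear_sum; apply: eq_bigr => i _ /=.
rewrite alphaTVE upd_comp alphaV_act alpha_alphaV_comp; congr (wedge (upd _ _ _)).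
by apply/funext => j /=; rewrite hl_alphaVK.
Qed.

Definition untwist_br : {linear extpow n g -> g} := hl_alphaV A \o hl_br A.

Fact untwist_morph (u : 'I_n -> g) :
  idfun (untwist_br (wedge u)) = untwist_br (wedge (idfun \o u)).
Proof. by []. Qed.

Fact untwist_jacobi (x : 'I_n.-1 -> g) (y : 'I_n -> g) :
  untwist_br (wedge (snoc (idfun \o x) (untwist_br (wedge y)))) =
  \sum_(i < n) untwist_br (wedge (upd (idfun \o y) i
                              (untwist_br (wedge (snoc x (y i)))))).
Proof.
have E u : untwist_br (wedge u) = av (hl_br A (wedge u)) by [].
(* The identity is the Hom-Jacobi identity with the inverse of alpha applied twice. *)
have -> : untwist_br (wedge (snoc (idfun \o x) (untwist_br (wedge y)))) =
    av (av (hl_br A (wedge (snoc (hl_alpha A \o x) (hl_br A (wedge y)))))).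
  by rewrite E alphaV_br [in RHS]alphaV_br alphaV_br !snoc_comp alpha_alphaV_comp.
rewrite hl_jacobi !linear_sum; apply: eq_bigr => i _ /=.
by rewrite [in LHS]alphaV_br upd_comp alpha_alphaV_comp.
Qed.

Definition untwist : nHomLie n g :=
  @NHomLie K n g untwist_br (idfun : {linear g -> g}) idfun
    (fun=> erefl) (fun=> erefl) untwist_morph untwist_jacobi.

Lemma act_untwist X z : act untwist X z = av (act A X z).
Proof.
elim/ext_ind: X => [|a x X IH].
  by rewrite !(linear_fun0 (act_linearl _ _)) linear0.
by rewrite !act_linearl hl_alphaV_linear IH !actE.
Qed.

Lemma brF_untwist X Y : brF untwist X Y = aV (brF A X Y).
Proof.
have n0 : (0 < n)%N by [].
elim/ext_ind: Y => [|a y Y IH].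
  by rewrite !(linear_fun0 (brF_linearr _ _ n0)) linear0.
rewrite !brF_linearr // alphaTV_linear IH !brF_derive //; congr (_ *: _ + _).
rewrite linear_sum; apply: eq_bigr => i _ /=.
by rewrite act_untwist alphaTVE upd_comp alpha_alphaV_comp.
Qed.

Lemma alphaT_untwist X : alphaT untwist X = X.
Proof.
elim/ext_ind: X => [|a x X IH]; first by rewrite linear0.
by rewrite linearP /= IH alphaTE.
Qed.

Definition untwist_rho (X : W) : {linear V -> V} := betaV \o rep_rho R X.

Lemma rho_betaV X v : rep_rho R X (betaV v) = betaV (rep_rho R (alphaT A X) v).
Proof. by rewrite -[v in RHS]betaVK rep_equivariant betaK. Qed.

Fact untwist_rho_linear (a : K) (X Y : W) (v : V) :
  untwist_rho (a *: X + Y) v = a *: untwist_rho X v + untwist_rho Y v.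
Proof. by rewrite /= rep_rho_linear linearP. Qed.

Fact untwist_equivariant (X : W) (v : V) :
  untwist_rho (alphaT untwist X) (idfun v) = idfun (untwist_rho X v).
Proof. by rewrite alphaT_untwist. Qed.

Fact untwist_commutator (X Y : W) (v : V) :
  untwist_rho (alphaT untwist X) (untwist_rho Y v) -
  untwist_rho (alphaT untwist Y) (untwist_rho X v) =
  untwist_rho (brF untwist X Y) (idfun v).
Proof.
(* Both inverses of beta move to the left, where axiom (ii) applies; axiom (i) then absorbs beta and
   the twist of [brF]. *)
rewrite !alphaT_untwist brF_untwist /= !rho_betaV -!linearB /= rep_commutator.
by rewrite -[brF A X Y](@alphaTVK _ _ _ A) rep_equivariant !betaK alphaTVK.
Qed.

Fact untwist_bracket (x : 'I_n.-2 -> g) (y : 'I_n -> g) (v : V) :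
  untwist_rho (wedge (snoc (idfun \o x) (untwist_br (wedge y)))) (idfun v) =
  \sum_(i < n) (-1) ^+ (n - i.+1) *:
    untwist_rho (wedge (omit i (idfun \o y))) (untwist_rho (wedge (snoc x (y i))) v).
Proof.
have alpha_snoc : wedge (snoc (hl_alpha A \o x) (hl_br A (wedge y))) =
    alphaT A (wedge (snoc x (av (hl_br A (wedge y))))) :> W.
  by rewrite alphaTE snoc_comp hl_alphaVK.
have := rep_bracket R x y v; rewrite alpha_snoc rep_equivariant.
(* One inverse of beta cancels the beta brought out by (i); the second makes the left side an
   untwisted action, and on the right both are distributed over the two factors. *)
move/(congr1 betaV); rewrite betaK => /(congr1 betaV) /= ->.
rewrite linear_sum linear_sum; apply: eq_bigr => i _ /=.
by rewrite linearZ linearZ rho_betaV alphaTE.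
Qed.

Definition untwist_rep : representation untwist V :=
  @Representation K n g untwist V untwist_rho untwist_rho_linear
    (idfun : {linear V -> V}) (Bijective (fun=> erefl) (fun=> erefl))
    untwist_equivariant untwist_commutator untwist_bracket.

Local Notation d0 := (nlie_d untwist_rep).

(** * The coboundary of the twisted data *)

Section Degree.
Variable p : nat.
Implicit Types f : cochain n g V p.+1.

Fact pull_linear f (X : 'I_p -> W) : linear (fun z => f (aV \o X) (av z)).
Proof.
have [_ fz _] := cochainP f.
by move=> a u v; rewrite linearP fz.
Qed.

(** f o alpha^-1 with its last argument curried into Hom(g, V), so that a cochain of degree p + 1
    has p slots in W. *)
Definition pull f (X : 'I_p -> W) : H := mk_lmap (@pull_linear f X).

Lemma pull_multilinear f : multilinear (pull f).
Proof.
have [fX _ _] := cochainP f.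
move=> i X a u v; apply: lmapP => z; rewrite lmap_addE lmap_scaleE /=.
by rewrite !upd_comp linearP fX.
Qed.

Lemma pull_skew f : skew_last (pull f).
Proof.
have [_ _ fs] := cochainP f.
move=> l X x x' z z' s lp sx; rewrite /= !upd_comp !alphaTVE.
by apply: fs => //; rewrite -!snoc_comp sx.
Qed.

Definition coboundary_fun f (X : 'I_p.+1 -> W) (z : g) : V :=
  rep_beta R (d0 (pull f) X z).

Fact coboundary_cochain f : coboundary_fun f \in cochain_pred (p := p.+2).
Proof.
have dL := nlie_d_multilinear untwist_rep (pull_multilinear f).
apply/asboolP; split=> [z i X a u v|X a u v|l X x x' z z' s lp sx].
- by rewrite /coboundary_fun dL lmap_addE lmap_scaleE linearP.
- by rewrite /coboundary_fun lmap_lin linearP.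
- rewrite /coboundary_fun.
  have dS : skew_last (d0 (pull f)).
    by apply: nlie_d_skew => //; [exact: pull_multilinear | exact: pull_skew].
  by rewrite (dS l X x x' z z' s lp sx) linearZ.
Qed.

Definition coboundary f : cochain n g V p.+2 := Cochain (coboundary_cochain f).

Fact coboundary_linear : linear coboundary.
Proof.
move=> a f h; apply: val_inj; apply/funext => X; apply/funext => z.
rewrite /= /coboundary_fun.
have -> : pull (a *: f + h) = a *: pull f + pull h.
  by apply/funext => Y; apply: lmapP.
rewrite /nlie_d leibniz_d_linear; first by rewrite lmap_addE lmap_scaleE linearP.
- exact: lact_linearr.
- exact: tact_linearr.
Qed.

HB.instance Definition _ := GRing.isLinear.Build K (cochain n g V p.+1)
  (cochain n g V p.+2) *:%R coboundary coboundary_linear.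

Lemma coboundaryE f x z :
  coboundary f (fun i => wedge (x i)) z = coboundary_formula R f x z.
Proof.
rewrite -[LHS]/(rep_beta R _) /nlie_d /leibniz_d /coboundary_formula.
rewrite lmap_addE lmap_sumE linearD linear_sum; congr (_ + _).
  rewrite -!big_split; apply: eq_bigr => i _.
  have betaB u v : rep_beta R (u - v) = rep_beta R u - rep_beta R v by rewrite linearB.
  rewrite lmap_scaleE linearZ lmap_addE lmap_oppE lmap_sumE lactE !betaB /= betaVK.
  rewrite [(-1) ^+ i.+2]exprS mulN1r scaleNr -scalerN -scaler_sumr -!scalerDr.
  rewrite opprB addrA linear_sum; congr (_ *: (_ + _ - _)).
    (* Of the two inverse twists in the bracket, one comes from [brF_untwist] and the other from
       [pull]. *)
    apply: eq_bigr => j _; rewrite brF_untwist -!alphaV_brF.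
    by rewrite -upd_comp.
  by rewrite act_untwist !alphaV_act.
rewrite lmap_scaleE linearZ_LR tact_wedge_sum -sumrN linear_sum scaler_sumr.
apply: eq_bigr => i _.
(* beta cancels its inverse in [untwist_rho]; the minus sign of [tact_wedge_sum] accounts for the
   [+ 1] in the exponent. *)
rewrite linearN linearZ /= betaVK scalerN scalerA -scaleNr -mulN1r; congr (_ *: _).
rewrite -exprD -exprS addn1 [(n + p.+1)%N]addnC addnBA //; exact: leqW (ltn_ord i).
Qed.

End Degree.

(** * Compatibility of the untwisted coboundary with alpha and beta *)

Fact twist_linear (phi : H) : linear (fun z => rep_beta R (phi (av z))).
Proof. by move=> a u v; rewrite hl_alphaV_linear lmap_lin linearP. Qed.

Definition twist (phi : H) : H := mk_lmap (@twist_linear phi).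

Fact twist_is_linear : linear twist.
Proof. by move=> a phi psi; apply: lmapP => z; rewrite /= linearP. Qed.

HB.instance Definition _ := GRing.isLinear.Build K H H *:%R twist twist_is_linear.

Lemma untwist_rho_twist X v :
  rep_beta R (untwist_rho (aV X) v) = untwist_rho X (rep_beta R v).
Proof. by rewrite /= betaVK -{2}[X](@alphaTVK _ _ _ A) rep_equivariant betaK. Qed.

Lemma twist_lact X phi : twist (lact untwist_rep (aV X) phi) = lact untwist_rep X (twist phi).
Proof.
apply: lmapP => z.
transitivity (rep_beta R (untwist_rho (aV X) (phi (av z)))
              - rep_beta R (phi (act untwist (aV X) (av z)))).
  by rewrite -linearB.
by rewrite untwist_rho_twist lactE !act_untwist -alphaV_act.
Qed.

Lemma twist_tact X phi : twist (tact untwist_rep (aV X) phi) = tact untwist_rep X (twist phi).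
Proof.
elim/ext_ind: X => [|a x X IH].
  by rewrite linear0 !(linear_fun0 (tact_linearl _ _)) linear0.
rewrite alphaTV_linear !tact_linearl twist_is_linear IH; congr (_ *: _ + _).
apply: lmapP => z; rewrite tact_wedge_sum.
rewrite -[LHS]/(rep_beta R (tact untwist_rep _ phi (av z))) alphaTVE tact_wedge_sum.
rewrite linearN linear_sum; congr (- _); apply: eq_bigr => i _.
rewrite linearZ; congr (_ *: _).
by rewrite -[RHS]untwist_rho_twist alphaTVE snoc_comp.
Qed.

(** Naturality moves the outer twist inside the untwisted coboundary, so two copies of the latter
    are composed directly. *)
Lemma coboundary_coboundary p (f : cochain n g V p.+1) : coboundary (coboundary f) = 0.
Proof.
apply: val_inj; apply/funext => X; apply/funext => z.
have pullE : pull (coboundary f) = d0 (fun Y => twist (pull f (aV \o Y))).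
  apply/funext => Y; transitivity (twist (d0 (pull f) (aV \o Y))); first exact: lmapP.
  apply: (@leibniz_d_natural _ _ _ _ _ _ aV twist).
  - by move=> X1 X2; rewrite !brF_untwist alphaV_brF.
  - exact: twist_lact.
  - exact: twist_tact.
rewrite -[LHS]/(rep_beta R (d0 (pull (coboundary f)) X z)) pullE nlie_d_d //.
  by rewrite -[(0 : H) z]/(0 : V) linear0.
by move=> i Y a u v; rewrite !upd_comp linearP pull_multilinear twist_is_linear.
Qed.

End Twisted.

Theorem theorem3p1 (K : closedFieldType) (charK : [pchar K] =i pred0)
    (n : nat) (hn : (2 <= n)%N) (g : lmodType K) (A : nHomLie n g)
    (V : lmodType K) (R : representation A V) :
  exists delta : forall p : nat,
      {linear cochain n g V p.+1 -> cochain n g V p.+2},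
    (forall (p : nat) (f : cochain n g V p.+1) (h : cochain n g V p.+2),
        h = delta p f <->
        forall (x : 'I_p.+1 -> 'I_n.-1 -> g) (z : g),
          h (fun i => wedge (x i)) z = coboundary_formula R f x z)
    /\ (forall (p : nat) (f : cochain n g V p.+1),
        delta p.+1 (delta p f) = 0).
Proof.
case: n hn A R => [//|[//|m]] _ A R; have [b bK bVK] := rep_beta_bij R.
(* The inverse of a bijective linear map is linear, so it can be packed as such. *)
pose betaV : {linear V -> V} :=
  HB.pack b (GRing.isLinear.Build K V V *:%R b (can2_linear bK bVK)).
have betaK : cancel (rep_beta R) betaV by [].
have betaVK : cancel betaV (rep_beta R) by [].
exists (fun p => @coboundary _ _ _ _ A R betaV betaK betaVK p); split=> [p f h|p f].
  split=> [-> x z|hE]; first exact: coboundaryE.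
  (* Uniqueness: for fixed [z] both cochains are multilinear in the remaining arguments, hence
     determined on decomposables. *)
  apply: val_inj; apply/funext => X; apply/funext => z; move: X.
  have [hL _ _] := cochainP h.
  have [dL _ _] := cochainP (coboundary betaK betaVK f).
  apply: ext_multilinear_eq (hL z) (dL z) _ => x.
  by rewrite hE -(coboundaryE betaK betaVK).
exact: coboundary_coboundary.
Qed.
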